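(* Let $p,q\in(0,1/2)$ and let $(X_1,X_2,Y)$ be binary random variables, each $\mathrm{Bern}(1/2)$, with $X_2-X_1-Y$ a Markov chain, such that $X_1=X_2\oplus Z$ with $Z\sim\mathrm{Bern}(q)$ independent of $X_2$, and $Y=X_1\oplus W$ with $W\sim\mathrm{Bern}(p)$ independent of $(X_1,X_2)$. Then for every $R\geq0$ the relevance-rate function with side information at both the encoder and the decoder is $$\mu_{\text{TW-CIB}}^{\text{ED}}(R)=1-h_2\left(h_2^{-1}\left(\left[h_2(q)-R\right]^{+}\right)\ast p\right).$$
   Context: All logarithms are base 2. $h_2(\cdot)$ is the binary entropy function and $h_2^{-1}:[0,1]\to[0,1/2]$ the inverse of its restriction to $[0,1/2]$; $a\ast b=a(1-b)+b(1-a)$; $[a]^+=\max\{a,0\}$; $\oplus$ is addition modulo 2. Let $(X_1^n,X_2^n,Y^n)$ be $n$ i.i.d. copies of $(X_1,X_2,Y)$. Here the encoder observes both $X_1^n$ and $X_2^n$ and the decoder observes $X_2^n$. A pair $(R,\mu)\in\mathbb{R}_{\geq0}^2$ is achievable if for every $\varepsilon>0$ there is $n_0(\varepsilon)$ such that for all $n>n_0(\varepsilon)$ there are a finite set $\mathcal{I}$ and a map $f:\{0,1\}^n\times\{0,1\}^n\to\mathcal{I}$ with $\frac1n\log|\mathcal{I}|\leq R+\varepsilon$ and, with $I=f(X_1^n,X_2^n)$, $\frac1nI(Y^n;I\,X_2^n)\geq\mu-\varepsilon$. The set of achievable pairs is $\mathcal{R}_{\text{TW-CIB}}^{\text{ED}}(1/2)$,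 and $\mu_{\text{TW-CIB}}^{\text{ED}}(R)=\sup\{\mu:(R,\mu)\in\mathcal{R}_{\text{TW-CIB}}^{\text{ED}}(1/2)\}$. *)

(* Defs.v *)
(* MathComp-Analysis development; the reals are an arbitrary [R : realType]. *)
From HB Require Import structures.
From mathcomp Require Import all_boot all_order all_algebra.
From mathcomp Require Import all_classical all_reals all_analysis.
Import Order.TTheory GRing.Theory Num.Theory.

Set Implicit Arguments.
Unset Strict Implicit.
Unset Printing Implicit Defensive.

Local Open Scope classical_set_scope.
Local Open Scope ring_scope.

(* [ln 0 = 0], so [0 * log2 0 = 0] as is usual for entropies. *)
Definition log2 (R : realType) (x : R) : R := ln x / ln 2.

Definition h2 (R : realType) (x : R) : R :=
  - x * log2 x - (1 - x) * log2 (1 - x).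

(* Meaningful on the image of [`[0, 1/2]] under [h2], i.e. on [`[0, 1]]. *)
Definition h2inv (R : realType) : R -> R :=
  'pinv_(fun=> 0) `[0, 1 / 2] (@h2 R).

Definition bconv (R : realType) (a b : R) : R := a * (1 - b) + b * (1 - a).

Definition pospart (R : realType) (a : R) : R := Num.max a 0.

Definition independent (d : measure_display) (T : measurableType d)
    (R : realType) (P : probability T R)
    (d1 d2 : measure_display) (A : measurableType d1) (B : measurableType d2)
    (U : T -> A) (V : T -> B) : Prop :=
  forall (E : set A) (F : set B), measurable E -> measurable F ->
    P ((U @^-1` E) `&` (V @^-1` F)) = (P (U @^-1` E) * P (V @^-1` F))%E.

(* [U - V - W] for discrete [U], [V], [W]: conditional independence of [U] and
   [W] given [V], without the division by [P(V = v)]. *)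
Definition markov_chain (d : measure_display) (T : measurableType d)
    (R : realType) (P : probability T R) (A B C : Type)
    (U : T -> A) (V : T -> B) (W : T -> C) : Prop :=
  forall (u : A) (v : B) (w : C),
    (P [set t | U t = u /\ V t = v /\ W t = w] * P [set t | V t = v] =
     P [set t | U t = u /\ V t = v] * P [set t | V t = v /\ W t = w])%E.

Definition joint_pmf (d : measure_display) (T : measurableType d)
    (R : realType) (P : probability T R) (X1 X2 Y : T -> bool)
    (s : bool * bool * bool) : R :=
  fine (P [set t | (X1 t, X2 t, Y t) = s]).

(* Law of [n] i.i.d. copies of a variable of law [Q]. *)
Definition iid_pmf (R : realType) (S : finType) (Q : S -> R) (n : nat)
    (s : {ffun 'I_n -> S}) : R :=
  \prod_(i < n) Q (s i).

Definition law (R : realType) (S A : finType) (p : S -> R) (U : S -> A)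
    (a : A) : R :=
  \sum_(s | U s == a) p s.

(* In bits; terms with [P(U = a, V = b) = 0] vanish. *)
Definition mutual_info (R : realType) (S A B : finType) (p : S -> R)
    (U : S -> A) (V : S -> B) : R :=
  \sum_(a : A) \sum_(b : B)
    (let pab := law p (fun s => (U s, V s)) (a, b) in
     pab * log2 (pab / (law p U a * law p V b))).

(* Coordinate processes on [{ffun 'I_n -> bool * bool * bool}], whose letters
   are the triples [(x1, x2, y)]. *)
Definition seqX1 (n : nat) (s : {ffun 'I_n -> bool * bool * bool}) :
  {ffun 'I_n -> bool} := [ffun i => (s i).1.1].
Definition seqX2 (n : nat) (s : {ffun 'I_n -> bool * bool * bool}) :
  {ffun 'I_n -> bool} := [ffun i => (s i).1.2].
Definition seqY (n : nat) (s : {ffun 'I_n -> bool * bool * bool}) :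
  {ffun 'I_n -> bool} := [ffun i => (s i).2].

Definition TWCIB_ED_region (R : realType) (Q : bool * bool * bool -> R) :
    set (R * R) :=
  [set x | [/\ 0 <= x.1, 0 <= x.2 &
    forall eps : R, 0 < eps ->
    exists n0 : nat, forall n : nat, (n0 < n)%N ->
    exists (I : finType)
           (f : {ffun 'I_n -> bool} -> {ffun 'I_n -> bool} -> I),
      n%:R^-1 * log2 (#|I|%:R : R) <= x.1 + eps /\
      x.2 - eps <= n%:R^-1 *
        mutual_info (@iid_pmf R _ Q n) (@seqY n)
          (fun s => (f (seqX1 s) (seqX2 s), seqX2 s))]].

Definition mu_TWCIB_ED (R : realType) (Q : bool * bool * bool -> R) (r : R) :
    R :=
  sup [set mu | TWCIB_ED_region Q (r, mu)].

(* Main.v *)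
Require Import Defs.
From HB Require Import structures.
From mathcomp Require Import all_boot all_order all_algebra.
From mathcomp Require Import all_classical all_reals all_analysis.
From mathcomp Require Import ring lra.
Import Order.TTheory GRing.Theory Num.Theory.
Set Implicit Arguments.
Unset Strict Implicit.
Unset Printing Implicit Defensive.
Local Open Scope classical_set_scope.
Local Open Scope ring_scope.

(** Since [Y^n] is uniform, [I(Y^n; I X2^n) = n - H(Y^n | I X2^n)].

    Converse: the convexity behind Mrs. Gerber's lemma is used through the
    tangent line [h(x * p) >= beta + lam h(x)] at [x = D], where
    [h(D) = h(q) - R].  A linear inequality tensorizes by the chain rule, giving
    [H(Y^n | I X2^n) >= n beta + lam H(X1^n | I X2^n)], and
    [H(X1^n | I X2^n) >= n h(q) - log |I|].

    Achievability: the encoder quantizes [Z^n = X1^n + X2^n] with a random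
    rate-distortion code at Hamming distortion [D], and the decoder predicts
    [Y^n] by adding the codeword to [X2^n].  By Gibbs' inequality the
    conditional entropy of [Y^n] is at most its cross entropy with respect to
    i.i.d. Bern(D * p) noise around this prediction. *)

(** * Binary entropy *)

Section monotone.
Variable R : realType.
Implicit Types (f df : R -> R) (a b : R).

(** The distortion [D = 0], reached once [R >= h(q)], escapes the general argument: the derivative
    of [h] is infinite there and the test channel becomes degenerate. The converse then uses the
    horizontal line [lam = 0], which only says that the noise level [p] cannot be undercut, and the
    code is built at a small positive distortion. The converse stays affine throughout because an
    affine inequality, unlike a composition with [h2inv], can be summed over fibres of different
    masses without Jensen's inequality. In the other direction the cross entropy is affine in the
    Hamming distance, so only the mean distortion of the code matters and no typicality involving
    [Y^n] is needed. *)

Lemma MVT_derive f df a b : a < b ->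
  (forall x, a <= x <= b -> is_derive x 1 f (df x)) ->
  exists2 c, a < c < b & f b - f a = df c * (b - a).
Proof.
move=> ab dfE.
have [||c] := @MVT R f df a b ab.
- by move=> x; rewrite in_itv/= => /andP[ax xb]; apply: dfE; rewrite !ltW.
- apply: derivable_within_continuous => x; rewrite in_itv/= => xab.
  by have [] := dfE x xab.
- by rewrite in_itv/= => cab ->; exists c.
Qed.

Lemma derive_ge0_le f df a b : a <= b ->
  (forall x, a <= x <= b -> is_derive x 1 f (df x)) ->
  (forall x, a < x < b -> 0 <= df x) -> f a <= f b.
Proof.
rewrite le_eqVlt => /predU1P[->//|ab] dfE df0.
have [c cab fE] := MVT_derive ab dfE.
by rewrite -subr_ge0 fE mulr_ge0 ?df0 ?subr_ge0 ?ltW.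
Qed.

Lemma derive_le0_ge f df a b : a <= b ->
  (forall x, a <= x <= b -> is_derive x 1 f (df x)) ->
  (forall x, a < x < b -> df x <= 0) -> f b <= f a.
Proof.
rewrite le_eqVlt => /predU1P[->//|ab] dfE df0.
have [c cab fE] := MVT_derive ab dfE.
by rewrite -subr_le0 fE mulr_le0_ge0 ?df0 ?subr_ge0 ?ltW.
Qed.

End monotone.

Section binary_entropy.
Variable R : realType.
Implicit Types x b D p : R.

(** Entropy in nats, so that derivatives carry no factor [ln 2]; [h2E] converts. *)
Definition hn x : R := - x * ln x - (1 - x) * ln (1 - x).
(** Opposite in sign to the usual logit: this is the derivative of [hn], positive to the left of
    [1/2]. *)
Definition logit x : R := ln (1 - x) - ln x.

Lemma h2E x : h2 x = hn x / ln 2.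
Proof. by rewrite /h2 /hn /log2; ring. Qed.

Lemma ln2_gt0 : 0 < ln 2 :> R.
Proof. by rewrite ln_gt0// ltr1n. Qed.

Lemma ln_leB1 x : 0 < x -> ln x <= x - 1.
Proof. by move=> x0; have := @le_ln1Dx R (x - 1); rewrite subrKC; apply; lra. Qed.

Lemma hn0 : hn 0 = 0.
Proof. by rewrite /hn subr0 ln1; ring. Qed.

Lemma hnC x : hn (1 - x) = hn x.
Proof. by rewrite /hn subKr; ring. Qed.

Lemma hn_ge0 x : 0 <= x <= 1 -> 0 <= hn x.
Proof.
move=> x01; have := @ln_le0 R x; have := @ln_le0 R (1 - x).
by rewrite /hn => h1 h2; have := h1 ltac:(lra); have := h2 ltac:(lra); nra.
Qed.

Lemma hn_gt0 x : 0 < x < 1 -> 0 < hn x.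
Proof.
move=> x01; have := @ln_lt0 R x x01; have := @ln_le0 R (1 - x).
by rewrite /hn => h1 h2; have := h1 ltac:(lra); nra.
Qed.

(** [ln t <= t - 1] at [t = b / x]: the pointwise form of the nonnegativity of relative entropy,
    from which the Gibbs bounds below are summed. *)
Lemma xlnx_gibbs x b : 0 <= x -> 0 < b -> x * (ln b - ln x) <= b - x.
Proof.
rewrite le_eqVlt => /predU1P[<-|x0] b0; first by rewrite mul0r subr0 ltW.
rewrite -ln_div// mulrC -ler_pdivlMr//.
apply: (le_trans (ln_leB1 _)); first by rewrite divr_gt0.
by rewrite mulrBl divff ?gt_eqF.
Qed.

Lemma hn_gibbs x b : 0 <= x <= 1 -> 0 < b < 1 ->
  hn x <= - x * ln b - (1 - x) * ln (1 - b).
Proof.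
move=> x01 b01; have := @xlnx_gibbs x b; have := @xlnx_gibbs (1 - x) (1 - b).
move=> h1 h2; have := h1 ltac:(lra) ltac:(lra); have := h2 ltac:(lra) ltac:(lra).
rewrite /hn; lra.
Qed.

(** The cross entropy against Bern([b]) is affine in [x] and touches [hn] at [b], so Gibbs'
    inequality amounts to concavity. *)
Lemma hn_tangent x b : 0 <= x <= 1 -> 0 < b < 1 ->
  hn x <= hn b + (x - b) * logit b.
Proof. by move=> x01 /(hn_gibbs x01); rewrite /hn /logit; lra. Qed.

Lemma is_derive_ln1B x : x < 1 ->
  is_derive x 1 (fun y : R => ln (1 - y)) (- (1 - x)^-1).
Proof.
move=> x1; have x1' : 0 < 1 - x by rewrite subr_gt0.
have D := is_derive1_ln x1'.
have D1 : is_derive x 1 (fun y : R => 1 - y) (-1).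
  by apply: is_derive_eq; ring.
by rewrite -mulrN1; apply: (@is_derive1_comp R (@ln R) (fun y => 1 - y)).
Qed.

Lemma is_derive_logit x : 0 < x < 1 ->
  is_derive x 1 logit (- (x * (1 - x))^-1).
Proof.
move=> /andP[x0 x1]; have D1 := is_derive_ln1B x1; have D2 := is_derive1_ln x0.
apply: is_derive_eq; field; lra.
Qed.

Lemma is_derive_hn x : 0 < x < 1 -> is_derive x 1 hn (logit x).
Proof.
move=> /andP[x0 x1]; have D1 := is_derive_ln1B x1; have D2 := is_derive1_ln x0.
rewrite /hn; apply: is_derive_eq; rewrite /logit /GRing.scale/=; field; lra.
Qed.

Lemma logit_half : logit (1 / 2) = 0.
Proof. by rewrite /logit -[X in ln X - _](_ : 1 / 2 = _) ?subrr//; lra. Qed.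

Lemma logit_gt0 x : 0 < x < 1 / 2 -> 0 < logit x.
Proof. by move=> x12; rewrite /logit subr_gt0 ltr_ln ?posrE; lra. Qed.

Lemma logit_ge0 x : 0 < x <= 1 / 2 -> 0 <= logit x.
Proof. by move=> x12; rewrite /logit subr_ge0 ler_ln ?posrE; lra. Qed.

Lemma hn_lt x b : 0 <= x < b -> b <= 1 / 2 -> hn x < hn b.
Proof.
move=> /andP[x0 xb] b12.
have [->|xn0] := eqVneq x 0; first by rewrite hn0 hn_gt0//; lra.
have {xn0}x0 : 0 < x by rewrite lt_neqAle eq_sym xn0.
have [|c cxb hE] := @MVT_derive R hn logit x b xb.
  by move=> y yxb; apply: is_derive_hn; lra.
by rewrite -subr_gt0 hE mulr_gt0 ?logit_gt0; lra.
Qed.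

(** With [s = 1 - 2 * x] this is [artanh s >= s]: the difference [logit x - 2 * (1 - 2 * x)]
    decreases and vanishes at [1/2]. *)
Lemma logit_ge x : 0 < x <= 1 / 2 -> 2 * (1 - 2 * x) <= logit x.
Proof.
move=> /andP[x0 x12].
have := @derive_le0_ge R (fun y => logit y - 2 * (1 - 2 * y))
  (fun y => - (y * (1 - y))^-1 + 4) x (1/2) x12.
rewrite logit_half => H.
suff : 0 - 2 * (1 - 2 * (1 / 2)) <= logit x - 2 * (1 - 2 * x) by lra.
apply: H => y yx.
  have y01 : 0 < y < 1 by lra.
  have D := is_derive_logit y01.
  apply: is_derive_eq; rewrite /GRing.scale/=; ring.
have y0 : 0 < y * (1 - y) by rewrite mulr_gt0; lra.
rewrite addrC subr_le0 -[X in _ <= X]div1r ler_pdivlMr//.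
have := sqr_ge0 (1 - 2 * y); nra.
Qed.

(* In the variable [s = 1 - 2x], where [logit x = 2 artanh s], this says that
   [(1 - s^2) artanh s / s] decreases. *)
Lemma logit_ratio_mono x y : 0 < x <= y -> y < 1 / 2 ->
  x * (1 - x) * logit x / (1 - 2 * x) <= y * (1 - y) * logit y / (1 - 2 * y).
Proof.
move=> /andP[x0 xy] y12.
pose df z : R := (logit z * (1 - 2 * z + 2 * z ^+ 2) - (1 - 2 * z)) / (1 - 2 * z) ^+ 2.
apply: (@derive_ge0_le R (fun z => z * (1 - z) * logit z / (1 - 2 * z)) df) => // z zxy.
  have z01 : 0 < z < 1 by lra.
  have z2 : 1 - 2 * z != 0 by rewrite gt_eqF//; lra.
  have D := is_derive_logit z01.
  have D2 : is_derive z 1 (fun y : R => (1 - 2 * y)^-1) (2 / (1 - 2 * z) ^+ 2).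
    have D1 : is_derive z 1 (fun y : R => 1 - 2 * y) (- 2).
      by apply: is_derive_eq; rewrite /GRing.scale/=; ring.
    have /is_derive_eq := (@is_deriveV R (fun y => 1 - 2 * y) z _ _ z2 D1); apply.
    by rewrite /GRing.scale/=; field.
  by apply: is_derive_eq; rewrite /df /GRing.scale/=; field; lra.
rewrite /df divr_ge0 ?sqr_ge0// subr_ge0.
(* The numerator is nonnegative because the lower bounds [2 * (1 - 2 * z)] and [1 / 2] of the two
   factors multiply to exactly the subtracted term. *)
have := @logit_ge z ltac:(lra).
have : 1 / 2 <= 1 - 2 * z + 2 * z ^+ 2 by have := sqr_ge0 (1 - 2 * z); nra.
set c := 1 - 2 * z + _; set L := logit z; nra.
Qed.

Lemma bconv_itv p x : 0 < p < 1 / 2 -> 0 <= x <= 1 ->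
  p <= bconv x p <= 1 - p.
Proof. by rewrite /bconv => p12 x01; apply/andP; split; nra. Qed.

Lemma is_derive_bconv (f : R -> R) p x d : is_derive (bconv x p) 1 f d ->
  is_derive x 1 (fun y => f (bconv y p)) (d * (1 - 2 * p)).
Proof.
move=> Df; apply: (@is_derive1_comp R f (fun y => bconv y p)).
by apply: is_derive_eq; rewrite /GRing.scale/=; ring.
Qed.

(** Up to the factor [1 - 2 * p], this quotient is the derivative of [hn (bconv x p)] with respect
    to [hn x], so its growth is convexity. Since [1 - 2 * bconv z p = (1 - 2 * p) * (1 - 2 * z)],
    the sign of its own derivative follows from [logit_ratio_mono] between [z] and [bconv z p]. *)
Lemma logit_bconv_ratio_mono p x y : 0 < p < 1 / 2 -> 0 < x <= y ->
  y < 1 / 2 -> logit (bconv x p) / logit x <= logit (bconv y p) / logit y.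
Proof.
move=> p12 /andP[x0 xy] y12.
pose df z : R := (logit (bconv z p) / (z * (1 - z)) -
  (1 - 2 * p) * logit z / (bconv z p * (1 - bconv z p))) / logit z ^+ 2.
apply: (@derive_ge0_le R (fun z => logit (bconv z p) / logit z) df) => // z zxy.
  have z01 : 0 < z < 1 by lra.
  have Lz : 0 < logit z by rewrite logit_gt0; lra.
  have Lz0 : logit z != 0 by rewrite gt_eqF.
  have b01 : 0 < bconv z p < 1 by have := @bconv_itv p z p12 ltac:(lra); lra.
  have D2 := is_derive_bconv (is_derive_logit b01).
  have D1 := is_deriveV Lz0 (is_derive_logit z01).
  apply: is_derive_eq; rewrite /df /GRing.scale/=; field.
  by rewrite Lz0; do ?[apply/andP; split]; rewrite ?gt_eqF; lra.
rewrite /df divr_ge0 ?sqr_ge0// subr_ge0.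
have zb : z <= bconv z p < 1 / 2 by rewrite /bconv; apply/andP; split; nra.
have b0 : 0 < bconv z p * (1 - bconv z p) by rewrite mulr_gt0; lra.
have z0 : 0 < z * (1 - z) by rewrite mulr_gt0; lra.
have := @logit_ratio_mono z (bconv z p) ltac:(lra) ltac:(lra).
have bE : 1 - 2 * bconv z p = (1 - 2 * p) * (1 - 2 * z).
  by rewrite /bconv; ring.
rewrite {}bE ler_pdivrMr ?subr_gt0; last lra.
rewrite invfM mulrA divfK; last by rewrite gt_eqF; lra.
rewrite ler_pdivlMr ?subr_gt0; last lra.
move=> h; rewrite ler_pdivrMr// mulrAC ler_pdivlMr//; lra.
Qed.

(* Tangent line to Wyner and Ziv's convex function [h2 (h2inv u * p)] at
   [u = h2 D], with the slope [lam]. *)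
Lemma hn_bconv_tangent p D : 0 < p < 1 / 2 -> 0 < D < 1 / 2 ->
  exists2 lam, 0 <= lam &
    forall x, 0 <= x <= 1 ->
      hn (bconv D p) + lam * (hn x - hn D) <= hn (bconv x p).
Proof.
move=> p12 D12.
have LD : 0 < logit D by rewrite logit_gt0.
pose lam := (1 - 2 * p) * (logit (bconv D p) / logit D).
have lam0 : 0 <= lam.
  apply: mulr_ge0; first lra.
  apply: divr_ge0; last exact: ltW.
  by apply: logit_ge0; rewrite /bconv; apply/andP; split; nra.
exists lam => //.
(* The claim is that [G] is minimal at [D]. The choice of [lam] makes [dG D] vanish, and the
   monotone quotient fixes the sign of [dG] on each side. *)
pose G x := hn (bconv x p) - lam * hn x.
pose dG x := (1 - 2 * p) * logit (bconv x p) - lam * logit x.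
have DG x : 0 < x < 1 -> is_derive x 1 G (dG x).
  move=> x01; have b01 : 0 < bconv x p < 1.
    by have := @bconv_itv p x p12 ltac:(lra); lra.
  have D1 := is_derive_hn x01; have D2 := is_derive_bconv (is_derive_hn b01).
  by apply: is_derive_eq; rewrite /dG /GRing.scale/=; ring.
have Gmin x : 0 < x <= 1 / 2 -> G D <= G x.
  move=> /andP[x0 x12]; case: (leP x D) => xD.
    apply: (@derive_le0_ge R G dG _ _ xD); first by move=> y yx; apply: DG; lra.
    move=> y yxD; have Ly : 0 < logit y by rewrite logit_gt0; lra.
    have := @logit_bconv_ratio_mono p y D p12 ltac:(lra) ltac:(lra).
    by rewrite ler_pdivrMr// /dG /lam; nra.
  apply: (@derive_ge0_le R G dG _ _ (ltW xD)); first by move=> y yx; apply: DG; lra.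
  move=> y yxD; have Ly : 0 < logit y by rewrite logit_gt0; lra.
  have := @logit_bconv_ratio_mono p D y p12 ltac:(lra) ltac:(lra).
  by rewrite ler_pdivlMr// /dG /lam; nra.
(* The derivative of [hn] is infinite at [0], so a nearby point is used: concavity gives
   [G x <= hn p + x * logit p], which for small [x] would fall below [G D] if [G 0 < G D]. *)
have G0 : G D <= G 0.
  rewrite {2}/G hn0 mulr0 subr0 leNgt; apply/negP.
  have -> : bconv 0 p = p by rewrite /bconv; ring.
  move=> hGD; have Lp : 0 < logit p by rewrite logit_gt0.
  pose t := (G D - hn p) / (2 * logit p).
  have t0 : 0 < t by rewrite divr_gt0; lra.
  pose x := Num.min t (1 / 2).
  have x12 : 0 < x <= 1 / 2 by rewrite /x lt_min ge_min t0 lexx orbT; lra.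
  have xt : x * logit p <= (G D - hn p) / 2.
    apply: (@le_trans _ _ (t * logit p)); first by rewrite ler_pM2r// ge_min lexx.
    by rewrite /t invfM mulrA -mulrA mulVf ?mulr1// gt_eqF.
  have := Gmin x x12; rewrite {2}/G.
  have := @hn_tangent (bconv x p) p.
  have := @bconv_itv p x p12 ltac:(lra) => b1 /(_ ltac:(lra) ltac:(lra)).
  have : 0 <= lam * hn x by rewrite mulr_ge0 ?hn_ge0; lra.
  have : bconv x p - p <= x by rewrite /bconv; nra.
  by nra.
have {}Gmin x : 0 <= x <= 1 / 2 -> G D <= G x.
  move=> /andP[]; rewrite le_eqVlt => /predU1P[<-//|x0 x12].
  by apply: Gmin; rewrite x0.
move=> x x01; suff : G D <= G x by rewrite /G; lra.
case: (leP x (1 / 2)) => x12; first by apply: Gmin; lra.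
have -> : G x = G (1 - x).
  rewrite /G hnC -(hnC (bconv x p)).
  by have -> : 1 - bconv x p = bconv (1 - x) p by rewrite /bconv; ring.
by apply: Gmin; lra.
Qed.

(** Provides explicit points of small entropy near [0]. Squaring tames the logarithm:
    [- x ^+ 2 * ln (x ^+ 2)] is [2 * x] times [- x * ln x], which is below [1]. *)
Lemma hn_sqr_le x : 0 < x < 1 -> hn (x ^+ 2) <= 3 * x.
Proof.
move=> x01; have x2 : 0 < 1 - x ^+ 2 by nra.
have := @ln_leB1 x^-1; have := @ln_leB1 (1 - x ^+ 2)^-1.
rewrite !invr_gt0 !lnV ?posrE; [|lra|lra].
move=> /(_ x2); rewrite -(ler_pM2l x2) mulrBr divff ?gt_eqF// => h1.
have x0 : 0 < x by lra.
move=> /(_ x0); rewrite -(ler_pM2l x0) mulrBr divff ?gt_eqF// => h2.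
rewrite /hn lnXn//; nra.
Qed.

Lemma hn_IVT q v : 0 < q < 1 / 2 -> 0 <= v <= hn q ->
  exists2 x, 0 <= x <= q & hn x = v.
Proof.
move=> q12 /andP[]; rewrite le_eqVlt => /predU1P[<-|v0 vq].
  by exists 0; rewrite ?hn0//; lra.
(* The intermediate value theorem runs on [[y ^+ 2, q]], away from the singularity at [0]. The bound
   [v / 4] puts the left value below [v] through [hn_sqr_le], and [q / 2] keeps [y ^+ 2] below
   [q]. *)
pose y := Num.min (v / 4) (q / 2).
have y0 : 0 < y by rewrite lt_min; lra.
have yq : y <= q / 2 by rewrite ge_min lexx orbT.
have yv : y <= v / 4 by rewrite ge_min lexx.
have yy : 0 < y ^+ 2 <= q by rewrite exprn_gt0//=; nra.
have hy : hn (y ^+ 2) <= v by have := @hn_sqr_le y ltac:(lra); lra.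
have hyq : hn (y ^+ 2) <= hn q by exact: le_trans hy vq.
have [|||x] := @IVT R hn (y ^+ 2) q v.
- lra.
- apply: derivable_within_continuous => x; rewrite in_itv/= => xy.
  by have [] := @is_derive_hn x ltac:(lra).
- by rewrite min_l// max_r// hy vq.
by rewrite in_itv/= => xy; exists x => //; lra.
Qed.

Lemma h2invP q v : 0 < q < 1 / 2 -> 0 <= v <= h2 q ->
  [/\ 0 <= h2inv v, h2inv v <= q & hn (h2inv v) = v * ln 2].
Proof.
move=> q12; rewrite h2E ler_pdivlMr ?ln2_gt0// => /andP[v0 vq].
have ln20 := ln2_gt0.
have [|x xq xE] := @hn_IVT q (v * ln 2) q12; first by rewrite mulr_ge0// ltW.
(* [pinv] is specified only on the image, so [v] is first placed there; injectivity later confines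
   the inverse to [[0, 1/2]]. *)
have vim : v \in (@h2 R @` `[0, 1 / 2])%classic.
  rewrite inE; exists x => /=; first by rewrite in_itv/=; lra.
  by rewrite h2E xE mulfK ?gt_eqF.
have hvE : hn (h2inv v) = v * ln 2.
  by rewrite -[in RHS](pinvK (fun=> 0) vim) h2E divfK ?gt_eqF.
have inj : {in `[0, 1 / 2]%classic &, injective (@h2 R)}.
  move=> y z; rewrite !inE/= !in_itv/= !h2E => y12 z12.
  move=> /(mulIf (invr_neq0 (lt0r_neq0 ln20))) yz.
  have [yz'|yz'|//] := ltgtP y z.
    by have := @hn_lt y z ltac:(lra) ltac:(lra); rewrite yz ltxx.
  by have := @hn_lt z y ltac:(lra) ltac:(lra); rewrite yz ltxx.
have : (@h2inv R @` (@h2 R @` `[0, 1 / 2]))%classic (h2inv v).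
  by exists v => //; rewrite inE in vim.
rewrite /h2inv injpinv_image//= in_itv/= -/(h2inv v) => /andP[h0 h1]; split=> //.
rewrite leNgt; apply/negP => qh; have := @hn_lt q (h2inv v).
by rewrite hvE => /(_ ltac:(lra) h1); lra.
Qed.

End binary_entropy.

Lemma bconv01 (R : realType) (a b : R) :
  0 <= a <= 1 -> 0 <= b <= 1 -> 0 <= bconv a b <= 1.
Proof.
move=> /andP[a0 a1] /andP[b0 b1]; rewrite /bconv.
have := mulr_ge0 a0 b0; have : 0 <= a * (1 - b) by rewrite mulr_ge0 ?subr_ge0.
have : 0 <= b * (1 - a) by rewrite mulr_ge0 ?subr_ge0.
have : 0 <= (1 - a) * (1 - b) by rewrite mulr_ge0 ?subr_ge0.
by move=> *; apply/andP; split; lra.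
Qed.

(** * Entropy of finite measures *)

Section entropy.
Variable R : realType.

(* Entropy of a finite measure that need not be normalized; conditional
   entropies are then plain sums of [ent] over fibres. *)
Definition ent (A : finType) (g : A -> R) : R :=
  \sum_a g a * (ln (\sum_b g b) - ln (g a)).

Lemma eq_ent (A : finType) (f g : A -> R) : f =1 g -> ent f = ent g.
Proof. by move=> fg; congr ent; apply/funext. Qed.

Lemma sum_gt0 (A : finType) (g : A -> R) a :
  (forall a, 0 <= g a) -> 0 < g a -> 0 < \sum_b g b.
Proof.
move=> g0 ga; apply: (lt_le_trans ga).
by rewrite (bigD1 a)//= lerDl sumr_ge0.
Qed.

(** Pointwise Gibbs with [b] rescaled to the mass of [g]; a total of [b] below 1 only helps. *)
Lemma ent_gibbs (A : finType) (g b : A -> R) :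
  (forall a, 0 <= g a) -> (forall a, 0 <= b a) ->
  (forall a, 0 < g a -> 0 < b a) -> \sum_a b a <= 1 ->
  ent g <= \sum_a g a * - ln (b a).
Proof.
move=> g0 b0 gb b1; rewrite -subr_le0 -sumrB.
set S := \sum_a g a.
apply: (@le_trans _ _ (\sum_a (S * b a - g a))); last first.
  rewrite sumrB -mulr_sumr -/S subr_le0 -[leRHS]mulr1.
  by rewrite ler_wpM2l// sumr_ge0.
apply: ler_sum => a _; have := g0 a; rewrite le_eqVlt => /predU1P[ga|ga].
  by rewrite -ga !mul0r !subr0 mulr_ge0// sumr_ge0.
have S0 : 0 < S := sum_gt0 g0 ga.
have := @xlnx_gibbs R (g a) (S * b a) (g0 a) (mulr_gt0 S0 (gb _ ga)).
by rewrite lnM ?posrE ?gb//; lra.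
Qed.

(** Conditioning on [c] lowers entropy: every [F c] is measured against the same normalized mixture,
    and these cross entropies add up to the entropy of the mixture. *)
Lemma ent_superadd (C A : finType) (F : C -> A -> R) :
  (forall c a, 0 <= F c a) ->
  \sum_c ent (F c) <= ent (fun a => \sum_c F c a).
Proof.
move=> F0; pose g a := \sum_c F c a; rewrite -/g; set S := \sum_a g a.
have g0 a : 0 <= g a by rewrite sumr_ge0.
have S0 : 0 <= S by rewrite sumr_ge0.
have -> : ent g = \sum_c \sum_a F c a * - ln (g a / S).
  rewrite exchange_big/=; apply: eq_bigr => a _; rewrite -mulr_suml -/(g a) -/S.
  have := g0 a; rewrite le_eqVlt => /predU1P[<-|ga]; first by rewrite !mul0r.
  by rewrite ln_div ?posrE ?opprB//; exact: sum_gt0 g0 ga.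
apply: ler_sum => c _; apply: ent_gibbs => // [a|a Fca|].
- by rewrite divr_ge0.
- have ga : 0 < g a by apply: lt_le_trans Fca _; rewrite /g (bigD1 c)//= lerDl sumr_ge0.
  by rewrite divr_gt0//; exact: sum_gt0 g0 ga.
rewrite -mulr_suml -/S; have := S0; rewrite le_eqVlt => /predU1P[<-|S1].
  by rewrite mul0r.
by rewrite divff ?gt_eqF.
Qed.

Lemma ent_scale (A : finType) (c : R) (g : A -> R) :
  0 <= c -> (forall a, 0 <= g a) -> ent (fun a => c * g a) = c * ent g.
Proof.
rewrite le_eqVlt => /predU1P[<-|c0] g0.
  by rewrite mul0r /ent big1// => a _; rewrite !mul0r.
rewrite /ent -mulr_sumr [RHS]mulr_sumr; apply: eq_bigr => a _.
have := g0 a; rewrite le_eqVlt => /predU1P[<-|ga]; first by rewrite mulr0 !mul0r mulr0.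
by rewrite !lnM ?posrE ?(sum_gt0 g0 ga)//; ring.
Qed.

Lemma ent_chain (A B : finType) (g : A * B -> R) :
  ent g = ent (fun b => \sum_a g (a, b)) + \sum_b ent (fun a => g (a, b)).
Proof.
have pairE (h : A * B -> R) : \sum_ab h ab = \sum_b \sum_a h (a, b).
  by rewrite exchange_big pair_big/=; apply: eq_bigr => -[].
rewrite /ent !pairE -big_split; apply: eq_bigr => b _ /=.
rewrite mulr_suml -big_split; apply: eq_bigr => a _ /=; ring.
Qed.

(** The label [h a] is determined by [a], so adjoining it leaves the entropy unchanged; by the chain
    rule, conditioning on it removes only its own entropy, which Gibbs against the uniform law
    bounds. *)
Lemma ent_partition (A I : finType) (m : A -> R) (h : A -> I) :
  (forall a, 0 <= m a) ->
  ent m - (\sum_a m a) * ln #|I|%:R <=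
  \sum_i ent (fun a => (h a == i)%:R * m a).
Proof.
move=> m0; pose g (ai : A * I) := (h ai.1 == ai.2)%:R * m ai.1.
have inner (F : A -> I -> R) a :
    \sum_i (h a == i)%:R * F a i = F a (h a).
  rewrite (bigD1 (h a))//= eqxx mul1r big1 ?addr0// => i.
  by rewrite eq_sym => /negPf ->; rewrite mul0r.
have gS : \sum_ai g ai = \sum_a m a.
  rewrite -(pair_big xpredT xpredT (fun a i => g (a, i)))/=.
  by apply: eq_bigr => a _; rewrite /g/= (inner (fun a _ => m a)).
have -> : ent m = ent g.
  rewrite [in RHS]/ent gS.
  rewrite -(pair_big xpredT xpredT (fun a i => g (a, i) * (ln (\sum_a m a) - ln (g (a, i)))))/=.
  apply: eq_bigr => a _; rewrite /g/=.
  have := inner (fun a i => m a * (ln (\sum_a m a) - ln ((h a == i)%:R * m a))) a.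
  by rewrite eqxx mul1r => <-; apply: eq_bigr => i _; rewrite mulrA.
rewrite ent_chain lerBlDr addrC lerD2l.
have n0 a i : 0 <= (h a == i)%:R * m a by rewrite mulr_ge0.
apply: le_trans (ent_gibbs (b := fun=> #|I|%:R^-1) _ _ _ _) _ => //.
- by move=> i; apply: sumr_ge0 => a _; exact: n0.
- by move=> i _; rewrite invr_gt0 ltr0n; apply/card_gt0P; exists i.
- rewrite sumr_const -[_ *+ _]mulr_natl; have [->|I0] := eqVneq #|I| 0%N.
    by rewrite mul0r.
  by rewrite divff// pnatr_eq0.
rewrite -mulr_suml -gS -(pair_big xpredT xpredT (fun a i => g (a, i)))/= exchange_big/=.
(* An empty [I] is covered by the conventions [0^-1 = 0] and [ln 0 = 0]. *)
have [I0|I0] := eqVneq #|I| 0%N; first by rewrite I0 invr0 ln0// oppr0.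
by rewrite lnV ?opprK// posrE ltr0n lt0n.
Qed.

Lemma sum_bernoulli (x : R) : \sum_b bernoulli_pmf x b = 1.
Proof. by rewrite big_bool/= subrKC. Qed.

Lemma sum_bernoulli_addb (x : R) c : \sum_b bernoulli_pmf x (c (+) b) = 1.
Proof. by case: c; rewrite big_bool/= ?subrKC// subrK. Qed.

Lemma ent_bernoulli (x : R) : ent (bernoulli_pmf x) = hn x.
Proof. by rewrite /ent sum_bernoulli ln1 big_bool/= /hn; ring. Qed.

End entropy.

(** * Sums over words; mean and variance under product laws *)

Section ffun_sums.
Variable R : realType.

Definition fcons (S : finType) n (x : S) (s : {ffun 'I_n -> S}) :
    {ffun 'I_n.+1 -> S} :=
  [ffun i => if unlift ord0 i is Some j then s j else x].

Lemma fcons0 (S : finType) n (x : S) (s : {ffun 'I_n -> S}) :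
  fcons x s ord0 = x.
Proof. by rewrite ffunE unlift_none. Qed.

Lemma fconsS (S : finType) n (x : S) (s : {ffun 'I_n -> S}) j :
  fcons x s (lift ord0 j) = s j.
Proof. by rewrite ffunE liftK. Qed.

Lemma sum_fcons (S : finType) n (F : {ffun 'I_n.+1 -> S} -> R) :
  \sum_s F s = \sum_(xs : S * {ffun 'I_n -> S}) F (fcons xs.1 xs.2).
Proof.
rewrite (reindex (fun xs : S * {ffun 'I_n -> S} => fcons xs.1 xs.2))//=.
exists (fun s => (s ord0, [ffun j => s (lift ord0 j)])) => [[x s] _|s _]/=.
  by rewrite fcons0; congr pair; apply/ffunP => j; rewrite ffunE fconsS.
apply/ffunP => i; case: (unliftP ord0 i) => [j ->|->]; last by rewrite fcons0.
by rewrite fconsS ffunE.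
Qed.

Lemma sum_ffun0 (S : finType) (F : {ffun 'I_0 -> S} -> R) s :
  \sum_t F t = F s.
Proof.
rewrite (bigD1 s)//= big1 ?addr0// => t /eqP[]; apply/ffunP => -[]//.
Qed.

Lemma sum_ffun_pair (I A B : finType) (F : {ffun I -> A * B} -> R) :
  \sum_s F s = \sum_(a : {ffun I -> A}) \sum_(b : {ffun I -> B})
    F [ffun i => (a i, b i)].
Proof.
rewrite pair_big/= (reindex (fun ab : {ffun I -> A} * {ffun I -> B} =>
  [ffun i => (ab.1 i, ab.2 i)]))//=.
exists (fun s => ([ffun i => (s i).1], [ffun i => (s i).2])) => [[a b] _|s _]/=.
  by congr pair; apply/ffunP => i; rewrite !ffunE.
by apply/ffunP => i; rewrite !ffunE -surjective_pairing.
Qed.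

Lemma sum_prod_ffun (I S : finType) (Q : I -> S -> R) :
  (forall i, \sum_x Q i x = 1) ->
  \sum_(s : {ffun I -> S}) \prod_i Q i (s i) = 1.
Proof. by move=> Q1; rewrite -bigA_distr_bigA big1. Qed.

Lemma sum_prod_ffun_coord (I S : finType) (Q : I -> S -> R) j (phi : S -> R) :
  (forall i, \sum_x Q i x = 1) ->
  \sum_(s : {ffun I -> S}) (\prod_i Q i (s i)) * phi (s j) =
  \sum_x Q j x * phi x.
Proof.
(* Absorbing [phi] into the factor [j] lets the sum of products split coordinatewise again. *)
move=> Q1; pose Q' i x := if i == j then Q i x * phi x else Q i x.
transitivity (\sum_(s : {ffun I -> S}) \prod_i Q' i (s i)).
  apply: eq_bigr => s _; rewrite (bigD1 j)//= [RHS](bigD1 j)//= /Q' eqxx mulrAC.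
  by congr (_ * _); apply: eq_bigr => i /negPf ->.
rewrite -bigA_distr_bigA (bigD1 j)//= [X in _ * X]big1 ?mulr1.
  by apply: eq_bigr => x _; rewrite /Q' eqxx.
by move=> i /negPf ij; rewrite /Q' ij.
Qed.

Lemma sum_iid (S : finType) (Q : S -> R) n : \sum_x Q x = 1 ->
  \sum_s @iid_pmf R S Q n s = 1.
Proof. by move=> Q1; rewrite /iid_pmf (sum_prod_ffun (Q := fun=> Q)). Qed.

Lemma iid_ge0 (S : finType) (Q : S -> R) n s : (forall x, 0 <= Q x) ->
  0 <= @iid_pmf R S Q n s.
Proof. by move=> Q0; rewrite prodr_ge0. Qed.

Lemma iid_gt0 (S : finType) (Q : S -> R) n s : (forall x, 0 < Q x) ->
  0 < @iid_pmf R S Q n s.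
Proof. by move=> Q0; rewrite prodr_gt0. Qed.

Lemma ln_iid (S : finType) (Q : S -> R) n s : (forall x, 0 < Q x) ->
  ln (@iid_pmf R S Q n s) = \sum_i ln (Q (s i)).
Proof.
move=> Q0; rewrite /iid_pmf; elim: (index_enum _) => [|i r IH].
  by rewrite !big_nil ln1.
by rewrite !big_cons lnM ?posrE ?IH// prodr_gt0.
Qed.

Lemma iid_mean (S : finType) (Q : S -> R) n (phi : S -> R) : \sum_x Q x = 1 ->
  \sum_s @iid_pmf R S Q n s * (\sum_i phi (s i)) = n%:R * \sum_x Q x * phi x.
Proof.
move=> Q1; under eq_bigr do rewrite mulr_sumr.
rewrite exchange_big/= (eq_bigr (fun=> \sum_x Q x * phi x)).
  by rewrite sumr_const card_ord mulr_natl.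
by move=> i _; exact: sum_prod_ffun_coord.
Qed.

Lemma iid_fcons (S : finType) (Q : S -> R) n x (s : {ffun 'I_n -> S}) :
  iid_pmf Q (fcons x s) = Q x * iid_pmf Q s.
Proof.
rewrite /iid_pmf big_ord_recl fcons0; congr (_ * _).
by apply: eq_bigr => i _; rewrite fconsS.
Qed.

(** Induction on the first letter: in the expanded square the cross term carries the mean of [phi],
    which is zero. *)
Lemma iid_variance (S : finType) (Q : S -> R) n (phi : S -> R) :
  \sum_x Q x = 1 -> \sum_x Q x * phi x = 0 ->
  \sum_s @iid_pmf R S Q n s * (\sum_i phi (s i)) ^+ 2 =
  n%:R * \sum_x Q x * phi x ^+ 2.
Proof.
move=> Q1 Q0; elim: n => [|n IH].
  by rewrite mul0r big1// => s _; rewrite big_ord0 expr0n/= mulr0.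
rewrite sum_fcons -(pair_big xpredT xpredT (fun x s =>
  iid_pmf Q (fcons x s) * (\sum_i phi (fcons x s i)) ^+ 2))/=.
rewrite (eq_bigr (fun x => Q x * phi x ^+ 2 + Q x * (n%:R * \sum_x Q x * phi x ^+ 2))).
  by rewrite big_split/= -mulr_suml Q1 -natr1; ring.
move=> x _; rewrite -IH.
transitivity (Q x * phi x ^+ 2 * (\sum_s @iid_pmf R S Q n s) +
   Q x * (2 * phi x * (\sum_s @iid_pmf R S Q n s * (\sum_i phi (s i)))) +
   Q x * \sum_(s : {ffun 'I_n -> S}) iid_pmf Q s * (\sum_i phi (s i)) ^+ 2).
  rewrite !mulr_sumr -!big_split/=; apply: eq_bigr => s _.
  rewrite iid_fcons big_ord_recl fcons0.
  rewrite (eq_bigr (fun i => phi (s i))); last by move=> i _; rewrite fconsS.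
  by ring.
by rewrite iid_mean// Q0 sum_iid//; ring.
Qed.

(** Only the upper tail is bounded: too large an information density or distortion is what spoils a
    code. *)
Lemma iid_chebyshev (S : finType) (Q : S -> R) n (phi : S -> R) (c : R) :
  (forall x, 0 <= Q x) -> \sum_x Q x = 1 -> 0 < c ->
  \sum_(s : {ffun 'I_n -> S} |
    n%:R * (\sum_x Q x * phi x) + c < \sum_i phi (s i)) iid_pmf Q s
  <= n%:R * (\sum_x Q x * (phi x - \sum_x Q x * phi x) ^+ 2) / c ^+ 2.
Proof.
move=> Q0 Q1 c0; set m := \sum_x Q x * phi x.
have psi0 : \sum_x Q x * (phi x - m) = 0.
  under eq_bigr do rewrite mulrBr.
  by rewrite sumrB -mulr_suml Q1 mul1r subrr.
rewrite -(iid_variance n Q1 psi0) ler_pdivlMr ?exprn_gt0//.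
rewrite mulr_suml [leRHS](bigID (fun s : {ffun 'I_n -> S} => n%:R * m + c < \sum_i phi (s i)))/=.
rewrite -[leLHS]addr0 lerD//; last by rewrite sumr_ge0// => s _; rewrite mulr_ge0 ?sqr_ge0 ?iid_ge0.
apply: ler_sum => s hs; rewrite ler_wpM2l ?iid_ge0//.
have -> : \sum_i (phi (s i) - m) = \sum_i phi (s i) - n%:R * m.
  by rewrite sumrB sumr_const card_ord mulr_natl.
by rewrite ler_sqr ?nnegrE; lra.
Qed.

End ffun_sums.

(** * Mrs. Gerber's lemma in linear form *)

Section gerber.
Variables (R : realType) (p lam beta : R).
Hypothesis p01 : 0 <= p <= 1.
Hypothesis scalar : forall x : R, 0 <= x <= 1 -> beta + lam * hn x <= hn (bconv x p).

Local Notation bsc := (fun x y : bool => bernoulli_pmf p (x (+) y)).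

(** Both sides are homogeneous in [u], so dividing by the total mass reduces to Bern([x]), where the
    claim is [scalar]. *)
Lemma gerber_bool (u : bool -> R) : (forall b, 0 <= u b) ->
  lam * ent u + beta * \sum_b u b <= ent (fun y => \sum_x u x * bsc x y).
Proof.
move=> u0; have : 0 <= \sum_b u b by rewrite sumr_ge0.
set S := \sum_b _; rewrite le_eqVlt => /predU1P[S0|S0].
  have uE b : u b = 0.
    have /eqP := S0; rewrite eq_sym psumr_eq0// => /allP/(_ b).
    by rewrite mem_index_enum/= => /(_ isT)/eqP.
  have -> : ent u = 0 by rewrite /ent big1// => b _; rewrite uE mul0r.
  rewrite -S0 !mulr0 addr0 /ent big1// => y _.
  by rewrite [X in X * _]big1 ?mul0r// => x _; rewrite uE mul0r.
pose x := u true / S.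
have SE : S = u true + u false by rewrite /S big_bool.
have uf0 := u0 false; have ut0 := u0 true.
have x01 : 0 <= x <= 1.
  by rewrite /x divr_ge0 ?(ltW S0)//= ler_pdivrMr// mul1r SE lerDl.
have uE b : u b = S * bernoulli_pmf x b.
  have xE : S * x = u true by rewrite /x mulrC divfK ?gt_eqF.
  by case: b; rewrite /= ?mulrBr xE// SE; ring.
have -> : ent u = S * hn x.
  rewrite (eq_ent uE) ent_scale ?ent_bernoulli ?ltW// => b.
  exact: bernoulli_pmf_ge0.
have gE y : \sum_b u b * bsc b y = S * bernoulli_pmf (bconv x p) y.
  by rewrite big_bool/= !uE /bconv; case: y => /=; ring.
have b01 := bconv01 x01 p01.
rewrite (eq_ent gE) ent_scale ?(ltW S0)//; last by move=> b; exact: bernoulli_pmf_ge0.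
rewrite ent_bernoulli mulrCA (mulrC beta) -mulrDr ler_wpM2l ?(ltW S0)//.
by rewrite addrC scalar.
Qed.

(** Tensorization by the chain rule on input and output. For the new letter, conditioning on the
    past input as well as the past output lowers the entropy of its output ([ent_superadd]); given
    the past input, the past output is irrelevant to it, so [gerber_bool] applies on each input
    fibre. *)
Lemma gerber_step (A B : finType) (K : A -> B -> R) C :
  (forall a b, 0 <= K a b) -> (forall a, \sum_b K a b = 1) ->
  (forall f : A -> R, (forall a, 0 <= f a) ->
    lam * ent f + C * \sum_a f a <= ent (fun b => \sum_a f a * K a b)) ->
  forall f : bool * A -> R, (forall xa, 0 <= f xa) ->
    lam * ent f + (beta + C) * \sum_xa f xa <=
    ent (fun yb : bool * B => \sum_xa f xa * (bsc xa.1 yb.1 * K xa.2 yb.2)).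
Proof.
move=> K0 K1 IH f f0; rewrite !ent_chain.
have sumE (h : bool * A -> R) : \sum_xa h xa = \sum_a \sum_x h (x, a).
  by rewrite exchange_big pair_big/=; apply: eq_bigr => -[].
have bsc0 x y : 0 <= bsc x y by exact: bernoulli_pmf_ge0.
pose f1 a := \sum_x f (x, a).
have -> : ent (fun b => \sum_y \sum_xa f xa * (bsc xa.1 y * K xa.2 b)) =
          ent (fun b => \sum_a f1 a * K a b).
  apply: eq_ent => b; rewrite exchange_big/= sumE; apply: eq_bigr => a _.
  rewrite mulr_suml; apply: eq_bigr => x _ /=.
  by rewrite -mulr_sumr -mulr_suml sum_bernoulli_addb mul1r.
have f10 a : 0 <= f1 a by rewrite sumr_ge0.
have := IH f1 f10.
suff : \sum_a (lam * ent (fun x => f (x, a)) + beta * f1 a) <=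
    \sum_b ent (fun y => \sum_xa f xa * (bsc xa.1 y * K xa.2 b)).
  by rewrite big_split/= -!mulr_sumr (sumE f) -/f1; lra.
apply: (@le_trans _ _ (\sum_b \sum_a ent (fun y => K a b * \sum_x f (x, a) * bsc x y))).
  rewrite exchange_big/=; apply: ler_sum => a _.
  have v0 y : 0 <= \sum_x f (x, a) * bsc x y by rewrite sumr_ge0// => x _; rewrite mulr_ge0.
  under eq_bigr do rewrite ent_scale//.
  by rewrite -mulr_suml K1 mul1r gerber_bool.
apply: ler_sum => b _; apply: le_trans (ent_superadd _) _.
  by move=> a y; rewrite mulr_ge0// sumr_ge0// => x _; rewrite mulr_ge0.
rewrite le_eqVlt; apply/predU1P; left; apply: eq_ent => y.
rewrite sumE; apply: eq_bigr => a _; rewrite mulr_sumr.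
by apply: eq_bigr => x _ /=; ring.
Qed.

Lemma gerber_iid n (f : {ffun 'I_n -> bool} -> R) : (forall x, 0 <= f x) ->
  lam * ent f + (n%:R * beta) * \sum_x f x <=
  ent (fun y : {ffun 'I_n -> bool} => \sum_x f x * \prod_i bsc (x i) (y i)).
Proof.
elim: n f => [|n IH] f f0.
  pose s0 : {ffun 'I_0 -> bool} := [ffun => true].
  by rewrite /ent !(sum_ffun0 _ s0) !subrr !mulr0 !mul0r addr0.
have entE (g : {ffun 'I_n.+1 -> bool} -> R) :
    ent g = ent (fun xs : bool * {ffun 'I_n -> bool} => g (fcons xs.1 xs.2)).
  by rewrite /ent !sum_fcons.
rewrite !entE sum_fcons.
have := @gerber_step _ _ (fun x y : {ffun 'I_n -> bool} => \prod_i bsc (x i) (y i)) (n%:R * beta).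
move=> /(_ _ _ IH (fun xs => f (fcons xs.1 xs.2))) H.
have -> : n.+1%:R * beta = beta + n%:R * beta by rewrite -natr1; ring.
apply: le_trans (H _ _ _) _ => //.
- by move=> x y; rewrite prodr_ge0// => i _; exact: bernoulli_pmf_ge0.
- move=> x; rewrite (sum_prod_ffun (Q := fun i => bsc (x i)))// => i.
  exact: sum_bernoulli_addb.
rewrite le_eqVlt; apply/predU1P; left; apply: eq_ent => -[y ys]/=.
rewrite sum_fcons; apply: eq_bigr => -[x xs] _ /=; congr (_ * _).
rewrite big_ord_recl !fcons0; congr (_ * _).
by apply: eq_bigr => i _; rewrite !fconsS.
Qed.

End gerber.

(** * Mutual information of the source *)

Section mutual_information.
Variable R : realType.

Lemma sum_law (S A : finType) (w : S -> R) (U : S -> A) :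
  \sum_a law w U a = \sum_s w s.
Proof. by rewrite [RHS](partition_big U xpredT). Qed.

Lemma law_marginal (S A B : finType) (w : S -> R) (U : S -> A) (V : S -> B) b :
  law w V b = \sum_a law w (fun s => (U s, V s)) (a, b).
Proof.
rewrite {1}/law (partition_big U xpredT)//=; apply: eq_bigr => a _.
by apply: eq_bigl => s; rewrite xpair_eqE andbC.
Qed.

(** Uniformity of [U] turns its entropy into the constant [- ln c], leaving the fibre entropies over
    [V] as the only varying part. *)
Lemma mutual_info_uniform (S A B : finType) (w : S -> R) (U : S -> A)
    (V : S -> B) c : (forall s, 0 <= w s) -> 0 < c ->
  (forall a, law w U a = c) ->
  mutual_info w U V * ln 2 = - ln c * (\sum_s w s) -
    \sum_b ent (fun a => law w (fun s => (U s, V s)) (a, b)).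
Proof.
move=> w0 c0 wU; rewrite /mutual_info exchange_big/=.
have -> : \sum_s w s = \sum_b \sum_a law w (fun s => (U s, V s)) (a, b).
  by rewrite -(sum_law w V); apply: eq_bigr => b _; exact: law_marginal.
rewrite mulr_sumr mulr_suml -sumrB; apply: eq_bigr => b _.
rewrite /ent mulr_sumr mulr_suml -sumrB; apply: eq_bigr => a _.
rewrite wU (law_marginal w U V b).
set g := fun a => law w (fun s => (U s, V s)) (a, b).
have g0 a' : 0 <= g a' by exact: sumr_ge0.
rewrite -/(g a); have := g0 a; rewrite le_eqVlt => /predU1P[<-|ga].
  by rewrite !(mul0r, mulr0) subrr.
have S0 := sum_gt0 g0 ga.
rewrite /log2 -mulrA divfK ?gt_eqF ?ln2_gt0//.
by rewrite ln_div ?lnM ?posrE ?mulr_gt0//; ring.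
Qed.

End mutual_information.

(** * Binary words and the memoryless binary symmetric channel *)

Section binary_sequences.
Variables (R : realType) (n : nat).
Local Notation seqn := {ffun 'I_n -> bool}.
Implicit Types (x y z u : seqn) (b p q : R).

Definition xorf x y : seqn := [ffun i => x i (+) y i].

Definition bsc_pmf p x y : R := \prod_i bernoulli_pmf p (x i (+) y i).

Definition hamming x y : R := \sum_i (x i (+) y i)%:R.

Lemma sum_ord_const (c : R) : \sum_(i < n) c = n%:R * c.
Proof. by rewrite sumr_const card_ord mulr_natl. Qed.

Lemma sum_seqn_const (c : R) : \sum_(x : seqn) 2^-1 ^+ n * c = c.
Proof.
rewrite sumr_const card_ffun card_bool card_ord -[_ *+ _]mulr_natl natrX.
by rewrite mulrA -exprMn divff ?pnatr_eq0// expr1n mul1r.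
Qed.

Lemma hammingC x y : hamming x y = hamming y x.
Proof. by apply: eq_bigr => i _; rewrite addbC. Qed.

Lemma hammingxx x : hamming x x = 0.
Proof. by rewrite /hamming big1// => i _; rewrite addbb. Qed.

Lemma xorfK y : involutive (xorf^~ y).
Proof. by move=> x; apply/ffunP => i; rewrite !ffunE addbK. Qed.

Lemma bsc_pmfE p x y : bsc_pmf p x y = iid_pmf (bernoulli_pmf p) (xorf x y).
Proof. by apply: eq_bigr => i _; rewrite ffunE. Qed.

Lemma bsc_pmfC p x y : bsc_pmf p x y = bsc_pmf p y x.
Proof. by apply: eq_bigr => i _; rewrite addbC. Qed.

Lemma sum_xorf (F : seqn -> R) y : \sum_x F (xorf x y) = \sum_x F x.
Proof. by rewrite [RHS](reindex_inj (inv_inj (xorfK y))). Qed.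

Lemma sum_bsc_pmf p y : \sum_x bsc_pmf p x y = 1.
Proof.
under eq_bigr do rewrite bsc_pmfE.
by rewrite sum_xorf sum_iid ?sum_bernoulli.
Qed.

Lemma sum_bsc_pmfr p x : \sum_y bsc_pmf p x y = 1.
Proof. by under eq_bigr do rewrite bsc_pmfC; exact: sum_bsc_pmf. Qed.

Lemma bernoulli_pmf_gt0 p c : 0 < p < 1 -> 0 < bernoulli_pmf p c.
Proof. by case: c => /=; lra. Qed.

Lemma bsc_pmf_gt0 p x y : 0 < p < 1 -> 0 < bsc_pmf p x y.
Proof. by move=> p01; rewrite prodr_gt0// => i _; exact: bernoulli_pmf_gt0. Qed.

Lemma ln_bsc_pmf p x y : 0 < p < 1 ->
  ln (bsc_pmf p x y) = n%:R * ln (1 - p) - logit p * hamming x y.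
Proof.
move=> p01; rewrite bsc_pmfE ln_iid => [|c]; last exact: bernoulli_pmf_gt0.
rewrite /hamming mulr_sumr -sum_ord_const -sumrB.
by apply: eq_bigr => i _; rewrite ffunE /logit; case: (_ (+) _) => /=; ring.
Qed.

(** In each coordinate the channel turns a mismatch [a] into [bconv a p], which is affine in [a].
    Hence the average depends on the words only through their distance. *)
Lemma bsc_hamming p x u :
  \sum_y bsc_pmf p x y * hamming u y = n%:R * p + (1 - 2 * p) * hamming u x.
Proof.
under eq_bigr do rewrite mulr_sumr.
rewrite exchange_big/= /hamming mulr_sumr -sum_ord_const -big_split/=; apply: eq_bigr => j _.
rewrite (sum_prod_ffun_coord (Q := fun i c => bernoulli_pmf p (x i (+) c)) j
  (fun c => (u j (+) c)%:R)); last by move=> i; exact: sum_bernoulli_addb.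
by rewrite big_bool; case: (x j); case: (u j) => /=; ring.
Qed.

Lemma ent_bsc p y : 0 < p < 1 -> ent (bsc_pmf p ^~ y) = n%:R * hn p.
Proof.
move=> p01; rewrite /ent sum_bsc_pmf ln1.
under eq_bigr do rewrite sub0r ln_bsc_pmf// opprB mulrBr.
rewrite sumrB -[X in _ - X]mulr_suml sum_bsc_pmf mul1r.
under eq_bigr do rewrite mulrCA bsc_pmfC.
under eq_bigr do rewrite hammingC.
by rewrite -mulr_sumr bsc_hamming hammingxx mulr0 addr0 /hn /logit; ring.
Qed.

End binary_sequences.

(** * Bounds on the mutual information of the [n]-letter source *)

Section source.
Variables (R : realType) (p q : R) (n : nat).
Hypotheses (p01 : 0 < p < 1) (q01 : 0 < q < 1).
Local Notation seqn := {ffun 'I_n -> bool}.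

Definition source_pmf (s : bool * bool * bool) : R :=
  2^-1 * bernoulli_pmf q (s.1.1 (+) s.1.2) * bernoulli_pmf p (s.1.1 (+) s.2).

Lemma source_pmf_ge0 s : 0 <= source_pmf s.
Proof. by rewrite !mulr_ge0 ?ltW ?bernoulli_pmf_gt0//; lra. Qed.

Lemma sum_source (Phi : seqn -> seqn -> seqn -> R) :
  \sum_s iid_pmf source_pmf s * Phi (seqX1 s) (seqX2 s) (seqY s) =
  \sum_x1 \sum_x2 \sum_y
    2^-1 ^+ n * bsc_pmf q x1 x2 * bsc_pmf p x1 y * Phi x1 x2 y.
Proof.
rewrite sum_ffun_pair sum_ffun_pair; apply: eq_bigr => x1 _.
apply: eq_bigr => x2 _; apply: eq_bigr => y _; congr (_ * _).
  rewrite /iid_pmf; under eq_bigr do rewrite !ffunE/=.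
  by rewrite !big_split/= prodr_const card_ord.
by congr (Phi _ _ _); apply/ffunP => i; rewrite !ffunE.
Qed.

Lemma source_law (A : finType) (V : seqn -> seqn -> seqn -> A) a :
  law (@iid_pmf R _ source_pmf n) (fun s => V (seqX1 s) (seqX2 s) (seqY s)) a =
  \sum_x1 \sum_x2 \sum_y 2^-1 ^+ n * bsc_pmf q x1 x2 * bsc_pmf p x1 y *
    (V x1 x2 y == a)%:R.
Proof.
rewrite -sum_source /law big_mkcond; apply: eq_bigr => s _.
by case: eqP; rewrite ?mulr1 ?mulr0.
Qed.

Lemma source_mutual_info (I : finType) (f : seqn -> seqn -> I) :
  mutual_info (@iid_pmf R _ source_pmf n) (@seqY n)
    (fun s => (f (seqX1 s) (seqX2 s), seqX2 s)) * ln 2 =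
  n%:R * ln 2 - \sum_x2 \sum_i ent (fun y => \sum_x1
    ((f x1 x2 == i)%:R * (2^-1 ^+ n * bsc_pmf q x1 x2)) * bsc_pmf p x1 y).
Proof.
have h0 : 0 < 2^-1 ^+ n :> R by rewrite exprn_gt0.
have w0 s : 0 <= @iid_pmf R _ source_pmf n s.
  by apply: iid_ge0; exact: source_pmf_ge0.
(* The channel is symmetric, so its kernel sums to one over inputs as well as outputs: summing out
   [x2], then [x1], leaves the uniform mass. *)
have lawY y : law (@iid_pmf R _ source_pmf n) (@seqY n) y = 2^-1 ^+ n.
  rewrite (source_law (fun _ _ y => y)).
  transitivity (\sum_x1 2^-1 ^+ n * bsc_pmf p x1 y); last first.
    by rewrite -mulr_sumr sum_bsc_pmf mulr1.
  apply: eq_bigr => x1 _.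
  transitivity (\sum_x2 bsc_pmf q x1 x2 * (2^-1 ^+ n * bsc_pmf p x1 y)).
    apply: eq_bigr => x2 _; rewrite (bigD1 y)//= eqxx mulr1 big1 => [|y' /negPf ->].
      by rewrite addr0; ring.
    by rewrite mulr0.
  by rewrite -mulr_suml sum_bsc_pmfr mul1r.
rewrite (mutual_info_uniform _ w0 h0 lawY).
congr (_ - _).
  rewrite sum_iid ?mulr1; last first.
    transitivity (\sum_x1x2 \sum_y source_pmf (x1x2, y)).
      by rewrite pair_big; apply: eq_bigr => -[].
    rewrite -(pair_big xpredT xpredT (fun x1 x2 => \sum_y source_pmf ((x1, x2), y)))/=.
    by rewrite !big_bool /source_pmf/=; field.
  by rewrite -lnV ?posrE// -exprVn invrK lnXn// mulr_natl.
rewrite [RHS]exchange_big [RHS]pair_big/=; apply: eq_bigr => -[i x2] _ /=.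
apply: eq_ent => y.
rewrite (source_law (fun x1 x2 y => (y, (f x1 x2, x2)))); apply: eq_bigr => x1 _.
rewrite (bigD1 x2)//= [X in _ + X]big1 ?addr0; last first.
  by move=> x /negPf xx2; rewrite big1// => y' _; rewrite !xpair_eqE xx2 !andbF mulr0.
rewrite (bigD1 y)//= [X in _ + X]big1 ?addr0; last first.
  by move=> y' /negPf yy'; rewrite !xpair_eqE yy' mulr0.
by rewrite !xpair_eqE !eqxx andbT; ring.
Qed.

(** For fixed [x2] the encoder cuts the law of [X1^n] into cells. [gerber_iid] acts on each cell,
    and [ent_partition] reassembles them at the cost of [ln #|I|%:R]. *)
Lemma mutual_info_le (lam beta : R) (I : finType) (f : seqn -> seqn -> I) :
  0 <= lam ->
  (forall x : R, 0 <= x <= 1 -> beta + lam * hn x <= hn (bconv x p)) ->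
  mutual_info (@iid_pmf R _ source_pmf n) (@seqY n)
    (fun s => (f (seqX1 s) (seqX2 s), seqX2 s)) * ln 2 <=
  n%:R * (ln 2 - beta) - lam * (n%:R * hn q - ln #|I|%:R).
Proof.
move=> lam0 scalar; rewrite source_mutual_info.
suff : n%:R * beta + lam * (n%:R * hn q - ln #|I|%:R) <= \sum_x2 \sum_i
  ent (fun y => \sum_x1 ((f x1 x2 == i)%:R * (2^-1 ^+ n * bsc_pmf q x1 x2)) * bsc_pmf p x1 y).
  by lra.
have h0 : 0 < 2^-1 ^+ n :> R by rewrite exprn_gt0.
have F0 x2 x1 i : 0 <= (f x1 x2 == i)%:R * (2^-1 ^+ n * bsc_pmf q x1 x2).
  by rewrite !mulr_ge0 ?(ltW h0)// ltW// bsc_pmf_gt0.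
pose F x2 i x1 := (f x1 x2 == i)%:R * (2^-1 ^+ n * bsc_pmf q x1 x2).
have Fsum x2 : \sum_i \sum_x1 F x2 i x1 = 2^-1 ^+ n.
  rewrite exchange_big/= -[in RHS](mulr1 (2^-1 ^+ n)).
  rewrite -[X in _ = _ * X](sum_bsc_pmf q x2) mulr_sumr.
  apply: eq_bigr => x1 _; rewrite (bigD1 (f x1 x2))//= /F eqxx mul1r.
  by rewrite big1 ?addr0// => i; rewrite eq_sym => /negPf ->; rewrite mul0r.
apply: (@le_trans _ _ (\sum_x2 \sum_i
  (lam * ent (F x2 i) + n%:R * beta * \sum_x1 F x2 i x1))); last first.
  apply: ler_sum => x2 _; apply: ler_sum => i _; apply: (gerber_iid _ scalar) => [|x1].
    by case/andP: p01 => *; rewrite !ltW.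
  exact: F0.
apply: (@le_trans _ _ (\sum_(x2 : seqn)
  (2^-1 ^+ n * (n%:R * beta + lam * (n%:R * hn q - ln #|I|%:R))))).
  by rewrite sum_seqn_const.
apply: ler_sum => x2 _; rewrite big_split/= -!mulr_sumr Fsum.
have := @ent_partition R _ _ (fun x1 => 2^-1 ^+ n * bsc_pmf q x1 x2) (f^~ x2).
rewrite -mulr_sumr sum_bsc_pmf mulr1 ent_scale ?ent_bsc ?(ltW h0)//; last first.
  by move=> x1; rewrite ltW// bsc_pmf_gt0.
move=> H; have {H} := ler_wpM2l lam0 (H _).
rewrite -/(F x2) => H; apply: le_trans (lerD (H _) (lexx _)); first lra.
by move=> x1; rewrite mulr_ge0 ?(ltW h0)// ltW// bsc_pmf_gt0.
Qed.

(** The parameter [b] of the reference noise is free here, since Gibbs' inequality needs no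
    knowledge of the true posterior of [Y^n]. *)
Lemma mutual_info_ge (b : R) (I : finType) (enc : seqn -> I) (dec : I -> seqn) :
  0 < b < 1 ->
  n%:R * (ln 2 + ln (1 - b)) - logit b * (n%:R * p + (1 - 2 * p) *
     \sum_z iid_pmf (bernoulli_pmf q) z * hamming R z (dec (enc z))) <=
  mutual_info (@iid_pmf R _ source_pmf n) (@seqY n)
    (fun s => (enc (xorf (seqX1 s) (seqX2 s)), seqX2 s)) * ln 2.
Proof.
move=> b01; rewrite (source_mutual_info (fun x1 x2 => enc (xorf x1 x2))).
have h0 : 0 < 2^-1 ^+ n :> R by rewrite exprn_gt0.
pose m := \sum_z @iid_pmf R _ (bernoulli_pmf q) n z * hamming R z (dec (enc z)).
rewrite -/m mulrDr -addrA lerD2l -[leLHS]opprK lerN2 opprD opprK.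
have w0 (x1 x2 : seqn) : 0 <= 2^-1 ^+ n * bsc_pmf q x1 x2.
  by rewrite !mulr_ge0 ?(ltW h0)// ltW// bsc_pmf_gt0.
pose C := - (n%:R * ln (1 - b)) + logit b * (n%:R * p + (1 - 2 * p) * m).
apply: (@le_trans _ _ (\sum_(x2 : seqn) 2^-1 ^+ n * C)); last first.
  by rewrite sum_seqn_const.
apply: ler_sum => x2 _.
pose F i x1 := (enc (xorf x1 x2) == i)%:R * (2^-1 ^+ n * bsc_pmf q x1 x2).
pose cost (u y : seqn) := - (n%:R * ln (1 - b)) + logit b * hamming R u y.
apply: (@le_trans _ _ (\sum_i \sum_y (\sum_x1 F i x1 * bsc_pmf p x1 y) * cost (xorf x2 (dec i)) y)).
  apply: ler_sum => i _.
  apply: le_trans (ent_gibbs (b := bsc_pmf b (xorf x2 (dec i))) _ _ _ _) _.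
  - by move=> y; rewrite sumr_ge0// => x1 _; rewrite !mulr_ge0 ?w0// ltW// bsc_pmf_gt0.
  - by move=> y; rewrite ltW// bsc_pmf_gt0.
  - by move=> y _; rewrite bsc_pmf_gt0.
  - by rewrite sum_bsc_pmfr.
  by apply: ler_sum => y _; rewrite ln_bsc_pmf// opprB addrC.
rewrite le_eqVlt; apply/predU1P; left.
transitivity (\sum_x1 2^-1 ^+ n * bsc_pmf q x1 x2 *
    \sum_y bsc_pmf p x1 y * cost (xorf x2 (dec (enc (xorf x1 x2)))) y).
  under eq_bigr => i _.
    under eq_bigr do rewrite mulr_suml.
    rewrite exchange_big/=; over.
  rewrite exchange_big/=; apply: eq_bigr => x1 _.
  rewrite (bigD1 (enc (xorf x1 x2)))//= [X in _ + X]big1 ?addr0; last first.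
    by move=> i; rewrite eq_sym => /negPf h; rewrite big1// => y _; rewrite /F h !mul0r.
  by rewrite mulr_sumr; apply: eq_bigr => y _; rewrite /F eqxx mul1r; ring.
under eq_bigr => x1 _.
  rewrite /cost; under eq_bigr do rewrite mulrDr mulrCA.
  rewrite big_split/= -mulr_suml sum_bsc_pmfr mul1r -mulr_sumr bsc_hamming.
  have -> : hamming R (xorf x2 (dec (enc (xorf x1 x2)))) x1 =
      hamming R (xorf x1 x2) (dec (enc (xorf x1 x2))).
    by apply: eq_bigr => i _; rewrite !ffunE; case: (x1 i); case: (x2 i); case: (_ i).
  rewrite bsc_pmfE; over.
(* The summand depends on [x1] and [x2] only through the noise word [z = xorf x1 x2], so the shift
   makes all [x2] contribute equally. *)
rewrite (sum_xorf (fun z => 2^-1 ^+ n * iid_pmf (bernoulli_pmf q) z *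
  (- (n%:R * ln (1 - b)) + logit b * (n%:R * p + (1 - 2 * p) * hamming R z (dec (enc z)))))).
transitivity (2^-1 ^+ n * ((- (n%:R * ln (1 - b)) + logit b * (n%:R * p)) *
   (\sum_z @iid_pmf R _ (bernoulli_pmf q) n z) + logit b * (1 - 2 * p) * m)).
  rewrite /m !mulr_sumr -big_split/= mulr_sumr; apply: eq_bigr => z _; ring.
by rewrite sum_iid ?sum_bernoulli//= /C; ring.
Qed.

End source.

(** * Rate-distortion codes *)

Section covering.
Variable R : realType.

Lemma exists_le_mean (U : finType) (P g : U -> R) :
  (forall u, 0 <= P u) -> \sum_u P u = 1 ->
  exists u, g u <= \sum_u P u * g u.
Proof.
move=> P0 P1; set m := \sum_u _; apply: contrapT => /forallNP gm.
have {}gm u : m < g u by rewrite ltNge; apply/negP.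
have : \sum_u P u * (g u - m) = 0.
  under eq_bigr do rewrite mulrBr.
  by rewrite sumrB -mulr_suml P1 mul1r subrr.
move/eqP; rewrite psumr_eq0 => [/allP Pg|u _]; last first.
  by rewrite mulr_ge0// subr_ge0 ltW.
move: P1; rewrite big1 => [/eqP|u _]; first by rewrite eq_sym oner_eq0.
have := Pg u; rewrite mem_index_enum => /(_ isT)/=; rewrite mulf_eq0.
by rewrite subr_eq0 (gt_eqF (gm u)) orbF => /eqP.
Qed.

(* Random coding: the codewords are drawn one at a time from [P], keeping each
   time one that does at least as well as the average. *)
Lemma exists_code (Z U : finType) (P : U -> R) (A : Z -> U -> bool) M
    (w : Z -> R) :
  (forall u, 0 <= P u) -> \sum_u P u = 1 -> (forall z, 0 <= w z) ->
  exists2 c : seq U, size c = M &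
    \sum_(z | ~~ has (A z) c) w z <=
    \sum_z w z * (1 - \sum_(u | A z u) P u) ^+ M.
Proof.
move=> P0 P1; elim: M w => [|M IH] w w0.
  by exists [::] => //=; apply: ler_sum => z _; rewrite expr0 mulr1.
pose a z := \sum_(u | A z u) P u.
have aC z : 1 - a z = \sum_(u | ~~ A z u) P u.
  by rewrite -P1 (bigID (A z))/= addrC addrK.
have a1 z : 0 <= 1 - a z by rewrite aC sumr_ge0.
(* The first codeword is judged by the bound that [M] further draws will give on the points it
   misses; the induction hypothesis is then used with the weights of the other points set to
   zero. *)
have [u hu] := exists_le_mean
  (fun u => \sum_(z | ~~ A z u) w z * (1 - a z) ^+ M) P0 P1.
have [c cM hc] := IH (fun z => (~~ A z u)%:R * w z)
  (fun z => mulr_ge0 (ler0n _ _) (w0 z)).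
exists (u :: c); first by rewrite /= cM.
have -> : \sum_(z | ~~ has (A z) (u :: c)) w z =
    \sum_(z | ~~ has (A z) c) (~~ A z u)%:R * w z.
  rewrite big_mkcond [RHS]big_mkcond; apply: eq_bigr => z _ /=.
  by case: (A z u); case: (has _ _); rewrite /= ?mul0r ?mul1r.
apply: (le_trans hc).
have -> : \sum_z (~~ A z u)%:R * w z * (1 - \sum_(u0 | A z u0) P u0) ^+ M =
    \sum_(z | ~~ A z u) w z * (1 - a z) ^+ M.
  rewrite [RHS]big_mkcond; apply: eq_bigr => z _.
  by case: (A z u); rewrite /= ?mul0r ?mul1r.
apply: (le_trans hu); rewrite le_eqVlt; apply/predU1P; left.
under eq_bigr => v _ do rewrite big_mkcond mulr_sumr.
rewrite exchange_big/=; apply: eq_bigr => z _.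
rewrite exprSr -/(a z) mulrA; set t := w z * _.
rewrite aC mulr_sumr [RHS]big_mkcond.
by apply: eq_bigr => v _; case: (A z v); rewrite /= ?mulr0// mulrC.
Qed.

(** The left side is convex in [x], and the right side is its chord between [x = 0] and [x = 1]. *)
Lemma onemM_expn_le (x y : R) M : 0 <= x <= 1 -> 0 <= y <= 1 ->
  (1 - x * y) ^+ M <= 1 - x + x * (1 - y) ^+ M.
Proof.
move=> /andP[x0 x1] /andP[y0 y1]; elim: M => [|M IH]; first by rewrite !expr0; lra.
have xy1 : 0 <= 1 - x * y by rewrite subr_ge0 mulr_ile1.
rewrite exprS; apply: le_trans (ler_wpM2l xy1 IH) _; rewrite exprS.
have t01 : 0 <= 1 - (1 - y) ^+ M by rewrite subr_ge0 exprn_ile1; lra.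
have : 0 <= x * y * (1 - x) * (1 - (1 - y) ^+ M).
  by rewrite !mulr_ge0// subr_ge0.
lra.
Qed.

(** The two error terms separate a joint draw falling outside [A] from a codebook too small for the
    likelihood ratio [expR tau]. *)
Lemma covering (Z U : finType) (PU : U -> R) (k : U -> Z -> R) (PZ : Z -> R)
    (A : Z -> U -> bool) (tau : R) M :
  (forall u, 0 <= PU u) -> \sum_u PU u = 1 ->
  (forall u z, 0 <= k u z) ->
  (forall z, 0 < PZ z) -> \sum_z PZ z = 1 ->
  (forall z, \sum_u PU u * k u z = PZ z) ->
  0 <= tau -> (forall z u, A z u -> k u z <= expR tau * PZ z) ->
  exists2 c : seq U, size c = M &
    \sum_(z | ~~ has (A z) c) PZ z <=
    \sum_u \sum_(z | ~~ A z u) PU u * k u z + expR (- (M%:R * expR (- tau))).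
Proof.
move=> PU0 PU1 k0 PZ0 PZ1 PZE tau0 kA.
have [c cM hc] := @exists_code Z U PU A M PZ PU0 PU1 (fun z => ltW (PZ0 z)).
exists c => //; apply: (le_trans hc).
(* [x z] is the posterior probability, given [z], that the word is good; the bound on [k] over [A]
   converts it into a [PU]-probability at the loss of a factor [y]. *)
pose x z := \sum_(u | A z u) PU u * k u z / PZ z.
pose y := expR (- tau).
have y01 : 0 <= y <= 1 by rewrite expR_ge0/= -expR0 ler_expR oppr_le0.
have xE z : PZ z * x z = \sum_(u | A z u) PU u * k u z.
  by rewrite /x -mulr_suml mulrC divfK ?gt_eqF.
have x01 z : 0 <= x z <= 1.
  rewrite sumr_ge0/= => [|u _]; last by rewrite divr_ge0 ?mulr_ge0 ?(ltW (PZ0 z)).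
  rewrite -(ler_pM2l (PZ0 z)) xE mulr1 -[leRHS]PZE [leRHS](bigID (A z))/=.
  by rewrite lerDl sumr_ge0// => u _; rewrite mulr_ge0.
have ax z : x z * y <= \sum_(u | A z u) PU u.
  rewrite /x mulr_suml; apply: ler_sum => u Au.
  rewrite /y expRN -!mulrA ler_piMr// -invfM ler_pdivrMr ?mul1r.
    by rewrite mulrC kA.
  by rewrite mulr_gt0// expR_gt0.
have a1 z : \sum_(u | A z u) PU u <= 1.
  by rewrite -PU1 [leRHS](bigID (A z))/= lerDl sumr_ge0.
apply: (@le_trans _ _ (\sum_z PZ z * (1 - x z + (1 - y) ^+ M))).
  apply: ler_sum => z _; rewrite ler_wpM2l ?(ltW (PZ0 z))//.
  apply: (@le_trans _ _ ((1 - x z * y) ^+ M)).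
    have := a1 z; have := ax z => *; rewrite lerXn2r ?nnegrE; lra.
  apply: le_trans (onemM_expn_le M (x01 z) y01) _; rewrite lerD2l ler_piMl//.
    by rewrite exprn_ge0//; lra.
  by have := x01 z; lra.
have PUZ z : PZ z * (1 - x z) = \sum_(u | ~~ A z u) PU u * k u z.
  by rewrite mulrBr mulr1 xE -[X in X - _]PZE (bigID (A z))/= addrC addrK.
under eq_bigr do rewrite mulrDr PUZ.
rewrite big_split/= -mulr_suml PZ1 mul1r lerD//.
  rewrite le_eqVlt; apply/predU1P; left.
  under eq_bigr do rewrite big_mkcond.
  by rewrite exchange_big/=; apply: eq_bigr => u _; rewrite -big_mkcond.
rewrite -mulrN expRM_natl lerXn2r ?nnegrE ?expR_ge0//; first lra.
exact: expR_ge1Dx.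
Qed.

End covering.

(** * Codes for the Bernoulli source under Hamming distortion *)

Section rate_distortion.
Variables (R : realType) (q D : R).
Hypothesis q12 : 0 < q < 1 / 2.
Hypothesis D0q : 0 < D <= q.

(* Test channel: [Z = U + V] with [V ~ Bern(D)] independent of [U ~ Bern(test_bias)]. *)
Definition test_bias : R := (q - D) / (1 - 2 * D).

Lemma test_bias01 : 0 <= test_bias <= 1.
Proof.
have hq := q12; have hD := D0q; have D2 : 0 < 1 - 2 * D by lra.
rewrite /test_bias divr_ge0/=; [|lra|lra].
by rewrite ler_pdivrMr// mul1r; lra.
Qed.

Lemma test_biasE : test_bias * (1 - D) + D * (1 - test_bias) = q.
Proof. by have hq := q12; have hD := D0q; rewrite /test_bias; field; lra. Qed.

Definition test_pmf (uz : bool * bool) : R :=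
  bernoulli_pmf test_bias uz.1 * bernoulli_pmf D (uz.1 (+) uz.2).

Lemma test_pmf_ge0 uz : 0 <= test_pmf uz.
Proof.
by have hq := q12; have hD := D0q; rewrite mulr_ge0 ?bernoulli_pmf_ge0 ?test_bias01//; lra.
Qed.

Lemma test_pmf_mean (phi : bool * bool -> R) :
  \sum_uz test_pmf uz * phi uz =
  test_bias * (1 - D) * phi (true, true) + test_bias * D * phi (true, false) +
  (1 - test_bias) * D * phi (false, true) + (1 - test_bias) * (1 - D) * phi (false, false).
Proof.
transitivity (\sum_u \sum_z test_pmf (u, z) * phi (u, z)).
  by rewrite pair_big; apply: eq_bigr => -[].
by rewrite !big_bool /test_pmf/=; ring.
Qed.

Lemma sum_test_pmf : \sum_uz test_pmf uz = 1.
Proof.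
transitivity (\sum_uz test_pmf uz * 1); first by apply: eq_bigr => *; rewrite mulr1.
by rewrite test_pmf_mean; ring.
Qed.

Definition info_density (uz : bool * bool) : R :=
  ln (bernoulli_pmf D (uz.1 (+) uz.2)) - ln (bernoulli_pmf q uz.2).

Lemma info_density_mean :
  \sum_uz test_pmf uz * info_density uz = hn q - hn D.
Proof.
rewrite test_pmf_mean /info_density/=.
transitivity (- (test_bias * (1 - D) + D * (1 - test_bias)) * ln q -
  (1 - (test_bias * (1 - D) + D * (1 - test_bias))) * ln (1 - q) - hn D).
  by rewrite /hn; ring.
by rewrite test_biasE.
Qed.

Lemma hamming_mean : \sum_uz test_pmf uz * (uz.1 (+) uz.2)%:R = D.
Proof. by rewrite test_pmf_mean/=; ring. Qed.

Lemma rate_distortion (delta : R) : 0 < delta ->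
  exists n0, forall n, (n0 < n)%N ->
  exists M (enc : {ffun 'I_n -> bool} -> 'I_M.+1)
    (dec : 'I_M.+1 -> {ffun 'I_n -> bool}),
    ln M.+1%:R <= n%:R * (hn q - hn D + delta) /\
    \sum_z iid_pmf (bernoulli_pmf q) z * hamming R z (dec (enc z)) <=
    n%:R * (D + delta).
Proof.
have hq := q12; have hD := D0q.
(* The rate spends three shares: one in [tau], one to enlarge the codebook, one on [ln 2] from
   rounding its size. The distortion spends one on [A] and one on failures. *)
move=> delta0; pose d := delta / 3; have d0 : 0 < d by rewrite divr_gt0.
pose V1 := \sum_uz test_pmf uz * (info_density uz - (hn q - hn D)) ^+ 2.
pose V2 := \sum_uz test_pmf uz * ((uz.1 (+) uz.2)%:R - D) ^+ 2.
(* [K / n] bounds the failure probability: two Chebyshev terms and the codebook term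
   [1 / (n * d)]. *)
pose K := (V1 + V2) / d ^+ 2 + 1 / d.
pose n0 := maxn (Num.truncn (K / d)) (Num.truncn (ln 2 / d)).
exists n0 => n n0n.
have Kn : K <= n%:R * d.
  rewrite -ler_pdivrMr// ltW// (lt_le_trans (truncnS_gt _))// ler_nat.
  by rewrite (leq_trans _ n0n)// ltnS leq_maxl.
have ln2n : ln 2 <= n%:R * d.
  rewrite -ler_pdivrMr// ltW// (lt_le_trans (truncnS_gt _))// ler_nat.
  by rewrite (leq_trans _ n0n)// ltnS leq_maxr.
have n0' : 0 < n%:R :> R by rewrite ltr0n (leq_trans _ n0n).
have nd0 : 0 < n%:R * d by rewrite mulr_gt0.
have hDq : hn D <= hn q.
  case/andP: D0q => D0; rewrite le_eqVlt => /predU1P[->//|Dq].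
  by rewrite ltW// hn_lt//; lra.
pose tau := n%:R * (hn q - hn D + d).
have tau0 : 0 <= tau by rewrite mulr_ge0// addr_ge0 ?subr_ge0// ltW.
pose M := Num.truncn (expR (tau + n%:R * d)).
(* The second condition bounds the information density, in the exponential form that [covering]
   takes. *)
pose A (z u : {ffun 'I_n -> bool}) := (hamming R u z <= n%:R * D + n%:R * d) &&
  (bsc_pmf D u z <= expR tau * iid_pmf (bernoulli_pmf q) z).
have q01 : 0 < q < 1 by lra.
have D01 : 0 < D < 1 by lra.
have bq0 b : 0 < bernoulli_pmf q b by exact: bernoulli_pmf_gt0.
have bt0 b : 0 <= bernoulli_pmf test_bias b by exact/bernoulli_pmf_ge0/test_bias01.
have [c cM hc] : exists2 c : seq {ffun 'I_n -> bool}, size c = M.+1 &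
    \sum_(z | ~~ has (A z) c) iid_pmf (bernoulli_pmf q) z <=
    \sum_u \sum_(z | ~~ A z u) iid_pmf (bernoulli_pmf test_bias) u * bsc_pmf D u z +
    expR (- (M.+1%:R * expR (- tau))).
  apply: covering => //.
  - by move=> u; exact: iid_ge0.
  - by rewrite sum_iid ?sum_bernoulli.
  - by move=> u z; rewrite ltW// bsc_pmf_gt0.
  - by move=> z; exact: iid_gt0.
  - by rewrite sum_iid ?sum_bernoulli.
  - move=> z; rewrite /iid_pmf /bsc_pmf.
    under eq_bigr do rewrite -big_split/=.
    rewrite -(bigA_distr_bigA (fun i b => bernoulli_pmf test_bias b * bernoulli_pmf D (b (+) z i))).
    apply: eq_bigr => i _; rewrite big_bool/=; have := test_biasE.
    by case: (z i) => /=; lra.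
  - by move=> z u /andP[].
have jointE (B : {ffun 'I_n -> bool * bool} -> bool) :
    \sum_(s | B s) iid_pmf test_pmf s =
    \sum_(u : {ffun 'I_n -> bool}) \sum_(z : {ffun 'I_n -> bool} | B [ffun i => (u i, z i)])
      iid_pmf (bernoulli_pmf test_bias) u * bsc_pmf D u z.
  rewrite big_mkcond sum_ffun_pair; apply: eq_bigr => u _.
  rewrite [RHS]big_mkcond; apply: eq_bigr => z _; case: ifP => // _.
  rewrite /iid_pmf /bsc_pmf -big_split/=; apply: eq_bigr => i _.
  by rewrite ffunE.
have P1 := @iid_chebyshev R _ test_pmf n info_density (n%:R * d)
  test_pmf_ge0 sum_test_pmf (mulr_gt0 n0' d0).
have P2 := @iid_chebyshev R _ test_pmf n (fun uz => (uz.1 (+) uz.2)%:R) (n%:R * d)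
  test_pmf_ge0 sum_test_pmf (mulr_gt0 n0' d0).
rewrite info_density_mean -/V1 jointE in P1.
rewrite hamming_mean -/V2 jointE in P2.
have chebE V : n%:R * V / (n%:R * d) ^+ 2 = V / d ^+ 2 / n%:R.
  by field; rewrite !gt_eqF.
rewrite chebE in P1; rewrite chebE in P2.
have PA : \sum_u \sum_(z | ~~ A z u) iid_pmf (bernoulli_pmf test_bias) u * bsc_pmf D u z
    <= (V1 + V2) / d ^+ 2 / n%:R.
  rewrite mulrDl mulrDl; apply: le_trans (lerD P1 P2).
  rewrite -big_split/=; apply: ler_sum => u _.
  rewrite big_mkcond [X in _ <= X + _]big_mkcond [X in _ <= _ + X]big_mkcond.
  rewrite -big_split/=; apply: ler_sum => z _.
  have w0 : 0 <= iid_pmf (bernoulli_pmf test_bias) u * bsc_pmf D u z.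
    by rewrite mulr_ge0 ?iid_ge0// ltW// bsc_pmf_gt0.
  set w := _ * _ in w0 *.
  have e1 : \sum_i info_density ([ffun i => (u i, z i)] i) =
      ln (bsc_pmf D u z) - ln (iid_pmf (bernoulli_pmf q) z).
    rewrite bsc_pmfE !ln_iid ?bq0//; last by move=> b; exact: bernoulli_pmf_gt0.
    by rewrite -sumrB; apply: eq_bigr => i _; rewrite !ffunE.
  have e2 : \sum_i (([ffun i => (u i, z i)] i).1 (+) ([ffun i => (u i, z i)] i).2)%:R
      = hamming R u z.
    by apply: eq_bigr => i _; rewrite !ffunE.
  rewrite e1 e2 -mulrDr -/tau /A.
  case: (leP (hamming R u z)) => _ /=; last first.
    by rewrite lerDr; case: ifP.
  case: (leP (bsc_pmf D u z)) => [_|h] /=; first by rewrite addr_ge0//; case: ifP.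
  rewrite ifT; first by rewrite addr0.
  have iq0 := iid_gt0 z bq0.
  rewrite ltrBrDr -ltr_expR expRD !lnK ?posrE// bsc_pmf_gt0//.
have Pexp : expR (- (M.+1%:R * expR (- tau))) <= 1 / d / n%:R.
  apply: (@le_trans _ _ (expR (- (n%:R * d)))).
    rewrite ler_expR lerN2; apply: (@le_trans _ _ (expR (n%:R * d))).
      by have := @expR_ge1Dx R (n%:R * d); lra.
    rewrite -[leLHS](_ : expR (tau + n%:R * d) * expR (- tau) = _).
      by rewrite ler_wpM2r ?expR_ge0// ltW// truncnS_gt.
    by rewrite -expRD; congr expR; ring.
  rewrite expRN div1r -invfM lef_pV2 ?posrE ?expR_gt0//; last by rewrite mulr_gt0.
  by have := @expR_ge1Dx R (n%:R * d); rewrite mulrC; lra.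
(* If no codeword is good, [find] returns the size [M.+1] and [inord] falls back to a default index;
   the distortion is then at most [n]. *)
exists M, (fun z => inord (find (A z) c)), (fun i => nth [ffun=> false] c i); split.
  have e0 := expR_gt0 (tau + n%:R * d).
  have : M.+1%:R <= 2 * expR (tau + n%:R * d).
    have : M%:R <= expR (tau + n%:R * d).
      by rewrite /M; have /andP[] := truncn_itv (ltW e0).
    have : 1 <= expR (tau + n%:R * d).
      by rewrite -[leLHS]expR0 ler_expR addr_ge0// ltW.
    by rewrite -natr1; lra.
  move=> leM; have {}leM : ln M.+1%:R <= ln (2 * expR (tau + n%:R * d)).
    by rewrite ler_ln ?posrE ?mulr_gt0// ltr0n.
  apply: (le_trans leM).
  rewrite lnM ?posrE// expRK /tau.
  have -> : delta = d + d + d by rewrite /d; field.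
  by rewrite !mulrDr; lra.
have hle (z u : {ffun 'I_n -> bool}) : hamming R z u <= n%:R.
  rewrite /hamming -[leRHS]mulr1 -sum_ord_const; apply: ler_sum => i _.
  by case: (_ (+) _).
apply: (@le_trans _ _ (\sum_z (iid_pmf (bernoulli_pmf q) z * (n%:R * D + n%:R * d) +
   (~~ has (A z) c)%:R * (iid_pmf (bernoulli_pmf q) z * n%:R)))).
  apply: ler_sum => z _.
  have pz0 := ltW (iid_gt0 z bq0).
  case: (boolP (has (A z) c)) => hA /=.
    rewrite mul0r addr0 ler_wpM2l// inordK; last by rewrite -cM -has_find.
    by rewrite hammingC; have := nth_find [ffun=> false] hA; case/andP.
  rewrite mul1r -[leLHS]add0r lerD//; last by rewrite ler_wpM2l.
  by rewrite mulr_ge0// addr_ge0// mulr_ge0 ?ltW//; lra.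
rewrite big_split/= -mulr_suml sum_iid ?sum_bernoulli// mul1r.
have -> : \sum_z (~~ has (A z) c)%:R * (iid_pmf (bernoulli_pmf q) z * n%:R) =
   n%:R * \sum_(z | ~~ has (A z) c) iid_pmf (bernoulli_pmf q) z.
  rewrite mulr_sumr [RHS]big_mkcond; apply: eq_bigr => z _.
  by case: (has _ _); rewrite /= ?mul0r// mul1r mulrC.
have hfail : \sum_(z | ~~ has (A z) c) iid_pmf (bernoulli_pmf q) z <= d.
  apply: (le_trans hc); apply: le_trans (lerD PA Pexp) _.
  by rewrite -mulrDl ler_pdivrMr// (mulrC d).
have := ler_wpM2l (ltW n0') hfail.
have -> : delta = d + d + d by rewrite /d; field.
by rewrite !mulrDr; lra.
Qed.

End rate_distortion.

(** * From the random variables to the single-letter law *)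

Lemma bernoulli_prob_set1 (R : realType) (p : R) b : 0 <= p <= 1 ->
  bernoulli_prob p [set b] = (bernoulli_pmf p b)%:E.
Proof. by move=> p01; rewrite /bernoulli_prob p01 fsbig_set1. Qed.

(** The triple is a bijective image of [(X2, Z, W)], so each atom is an intersection of events on
    these three, which independence factorizes. *)
Lemma joint_pmf_source (R : realType) (p q : R) (d : measure_display)
    (T : measurableType d) (P : probability T R)
    (X1 X2 Y Z W : {RV P >-> bool}) :
  0 <= p <= 1 -> 0 <= q <= 1 ->
  distribution P X2 =1 bernoulli_prob (1 / 2) ->
  (forall t, X1 t = X2 t (+) Z t) ->
  distribution P Z =1 bernoulli_prob q ->
  independent P Z X2 ->
  (forall t, Y t = X1 t (+) W t) ->
  distribution P W =1 bernoulli_prob p ->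
  independent P W (fun t => (X1 t, X2 t)) ->
  joint_pmf P X1 X2 Y = source_pmf p q.
Proof.
move=> p01 q01 hX2 hX1Z hZ hZX2 hYW hW hWX; apply/funext => -[[x1 x2] y].
have mb (b : bool) : measurable [set b] by [].
rewrite /joint_pmf /source_pmf/=.
have -> : [set t | (X1 t, X2 t, Y t) = (x1, x2, y)] =
    (W @^-1` [set x1 (+) y]) `&` ((fun t => (X1 t, X2 t)) @^-1` ([set x1] `*` [set x2])).
  apply/seteqP; split=> t /=.
    by rewrite hYW => -[<- <- <-]; rewrite addKb.
  by rewrite hYW => -[-> [-> ->]]; rewrite addKb.
rewrite hWX//; last exact: measurableX.
have -> : (fun t => (X1 t, X2 t)) @^-1` ([set x1] `*` [set x2]) =
    (Z @^-1` [set x1 (+) x2]) `&` (X2 @^-1` [set x2]).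
  apply/seteqP; split=> t /=.
    by rewrite hX1Z => -[<- <-]; rewrite addbAC addbb.
  by rewrite hX1Z => -[-> ->]; rewrite addbC addbK.
rewrite hZX2//.
have -> : P (W @^-1` [set x1 (+) y]) = (bernoulli_pmf p (x1 (+) y))%:E.
  by rewrite -bernoulli_prob_set1// -hW.
have -> : P (Z @^-1` [set x1 (+) x2]) = (bernoulli_pmf q (x1 (+) x2))%:E.
  by rewrite -bernoulli_prob_set1// -hZ.
have -> : P (X2 @^-1` [set x2]) = (2^-1)%:E.
  have -> : P (X2 @^-1` [set x2]) = bernoulli_prob (1 / 2) [set x2] by rewrite -hX2.
  rewrite bernoulli_prob_set1; last by apply/andP; split; lra.
  by congr EFin; case: x2 => /=; field.
by rewrite -!EFinM/=; ring.
Qed.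

(** * The relevance-rate function *)

Section region.
Variables (R : realType) (p q r : R).
Hypothesis p12 : 0 < p < 1 / 2.
Hypothesis q12 : 0 < q < 1 / 2.
Hypothesis r0 : 0 <= r.

Definition dstar : R := h2inv (pospart (h2 q - r)).

Lemma pospart_itv : 0 <= pospart (h2 q - r) <= h2 q.
Proof.
rewrite /pospart le_max lexx orbT/= ge_max gerBl r0/= h2E.
have hq := q12; rewrite divr_ge0 ?(ltW (ln2_gt0 _))// hn_ge0//; lra.
Qed.

Lemma dstar_le : 0 <= dstar <= q.
Proof. by have [-> ->] := h2invP q12 pospart_itv. Qed.

(** Either the rate binds exactly at a positive distortion, or it suffices to describe [Z^n]
    outright. *)
Lemma dstarP : 0 < dstar /\ hn q - hn dstar = r * ln 2 \/
  dstar = 0 /\ hn q <= r * ln 2.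
Proof.
have hq := q12; have [D0 Dq hD] := h2invP q12 pospart_itv.
rewrite -/dstar in D0 Dq hD; have ln20 : 0 < ln 2 :> R := ln2_gt0 R.
have hqE : h2 q * ln 2 = hn q by rewrite h2E divfK ?gt_eqF.
case: (ltP r (h2 q)) => rq; [left|right].
  have vE : pospart (h2 q - r) = h2 q - r by rewrite /pospart max_l// subr_ge0 ltW.
  split; last by rewrite hD vE mulrBl hqE; ring.
  rewrite lt_neqAle D0 andbT; apply/eqP => D0'.
  move: hD; rewrite -D0' hn0 vE => /esym/eqP; rewrite mulf_eq0 subr_eq0.
  by rewrite !gt_eqF.
split; last by rewrite -hqE ler_pM2r.
have vE : pospart (h2 q - r) = 0 by rewrite /pospart max_r// subr_le0.
apply/eqP; rewrite eq_le D0 andbT leNgt; apply/negP => D1.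
by have := @hn_gt0 R dstar; rewrite hD vE mul0r ltxx => /(_ ltac:(lra)).
Qed.

Lemma converse_slope : exists2 lam, 0 <= lam &
  forall n (I : finType) (f : {ffun 'I_n -> bool} -> {ffun 'I_n -> bool} -> I),
  (0 < n)%N ->
  n%:R^-1 * mutual_info (@iid_pmf R _ (source_pmf p q) n) (@seqY n)
    (fun s => (f (seqX1 s) (seqX2 s), seqX2 s)) <=
  1 - h2 (bconv dstar p) + lam * (n%:R^-1 * log2 #|I|%:R - r).
Proof.
have hp := p12; have hq := q12; have hD := dstar_le.
have ln20 : 0 < ln 2 :> R := ln2_gt0 R.
(* The rate equation is multiplied by [lam] so that it holds in both regimes. *)
have [lam lam0 [slope rate]] : exists2 lam, 0 <= lam &
    (forall x, 0 <= x <= 1 ->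
      hn (bconv dstar p) + lam * (hn x - hn dstar) <= hn (bconv x p)) /\
    lam * (hn q - hn dstar) = lam * (r * ln 2).
  case: dstarP => [[D0 DE]|[-> _]].
    have [lam lam0 lamE] := @hn_bconv_tangent R p dstar p12 ltac:(lra).
    by exists lam => //; rewrite DE.
  (* With [lam = 0] the claim is [hn p <= hn (bconv x p)], true because [bconv x p] lies in
     [[p, 1 - p]]. *)
  exists 0 => //; split; last by rewrite !mul0r.
  move=> x x01; rewrite mul0r addr0.
  have -> : bconv 0 p = p by rewrite /bconv; ring.
  have hb := bconv_itv p12 x01; case: (leP (bconv x p) (1 / 2)) => b12.
    case/andP: hb; rewrite le_eqVlt => /predU1P[<-//|pb _].
    by rewrite ltW// hn_lt//; lra.
  rewrite -(hnC (bconv x p)); have : p <= 1 - bconv x p by lra.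
  rewrite le_eqVlt => /predU1P[<-//|pb].
  by rewrite ltW// hn_lt//; lra.
exists lam => // n I f n0.
have n0' : 0 < n%:R :> R by rewrite ltr0n.
have := @mutual_info_le R p q n ltac:(lra) ltac:(lra) lam
  (hn (bconv dstar p) - lam * hn dstar) I f lam0.
move=> /(_ _)/wrap[x x01|H]; first by have := slope x x01; lra.
rewrite mulrC ler_pdivrMr// -(ler_pM2r ln20); apply: (le_trans H).
have -> : (1 - h2 (bconv dstar p) + lam * (n%:R^-1 * log2 #|I|%:R - r)) * n%:R * ln 2 =
  n%:R * (ln 2 - hn (bconv dstar p)) + lam * ln #|I|%:R - n%:R * (lam * (r * ln 2)).
  by rewrite h2E /log2; field; rewrite !gt_eqF.
by rewrite -rate; lra.
Qed.

Lemma region_le mu : TWCIB_ED_region (source_pmf p q) (r, mu) ->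
  mu <= 1 - h2 (bconv dstar p).
Proof.
move=> [_ _ hreg]; have [lam lam0 conv] := converse_slope.
apply/ler_addgt0Pr => e e0.
have lam1 : 0 < 1 + lam by lra.
(* With tolerance [e / (1 + lam)], the relevance loses one tolerance and the excess rate [lam] of
   them, together [e]. The converse is nonasymptotic, so one length suffices. *)
have [n0 /(_ n0.+1 (ltnSn _))[I [f /= [hR hMI]]]] := hreg (e / (1 + lam)) (divr_gt0 e0 lam1).
have combine (e' x C : R) : mu - e' <= C + lam * (x - r) ->
    e' + lam * e' = e -> lam * x <= lam * (r + e') -> mu <= C + e by lra.
apply: combine (le_trans hMI (conv _ I f (ltn0Sn n0))) _ (ler_wpM2l lam0 hR).
by field; rewrite gt_eqF.
Qed.

Lemma region_mem : TWCIB_ED_region (source_pmf p q) (r, 1 - h2 (bconv dstar p)).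
Proof.
have hp := p12; have hq := q12; have hD := dstar_le.
have ln20 : 0 < ln 2 :> R := ln2_gt0 R.
set b := bconv dstar p.
have b12 : p <= b <= 1 / 2 by rewrite /b /bconv; apply/andP; split; nra.
have L0 : 0 <= logit b by rewrite logit_ge0//; lra.
split => //=.
  rewrite subr_ge0 h2E ler_pdivrMr// mul1r.
  have := @hn_gibbs R b (1 / 2) ltac:(lra) ltac:(lra).
  have -> : 1 - 1 / 2 = 2^-1 :> R by field.
  by rewrite div1r lnV ?posrE//; lra.
(* The excess distortion is at most [2 * delta], one from [D'] and one from the code, and costs
   [logit b] per unit; the remaining [delta] covers the rate. *)
move=> eps eps0; pose delta := eps * ln 2 / (1 + 2 * logit b).
have L1 : 0 < 1 + 2 * logit b by lra.
have delta0 : 0 < delta by rewrite !mulr_gt0 ?invr_gt0.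
have deltaE : delta + 2 * logit b * delta = eps * ln 2.
  by rewrite /delta; field; rewrite gt_eqF.
(* The test channel needs positive distortion. When [dstar = 0], a small [D'] keeps the rate
   admissible because [hn q <= r * ln 2] already. *)
have [D' D'q [D'D rate]] : exists2 D', 0 < D' <= q &
    D' <= dstar + delta /\ hn q - hn D' <= r * ln 2.
  case: dstarP => [[D0 DE]|[DE rq]].
    by exists dstar; [lra|split; lra].
  exists (Num.min delta q); first by rewrite lt_min delta0 ge_min lexx orbT; lra.
  rewrite DE add0r ge_min lexx; split => //.
  have : 0 <= hn (Num.min delta q) by rewrite hn_ge0// le_min ge_min; lra.
  by lra.
have [n0 hn0] := rate_distortion q12 D'q delta0.
exists n0 => n n0n; have [M [enc [dec [hM hdist]]]] := hn0 n n0n.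
have n1 : 0 < n%:R :> R by rewrite ltr0n (leq_trans _ n0n).
exists 'I_M.+1, (fun x1 x2 => enc (xorf x1 x2)); rewrite card_ord; split.
  rewrite mulrC ler_pdivrMr// /log2 ler_pdivrMr//; apply: (le_trans hM).
  have -> : (r + eps) * n%:R * ln 2 = n%:R * (r * ln 2 + eps * ln 2) by ring.
  by rewrite ler_pM2l//; have := mulr_ge0 L0 (ltW delta0); lra.
have := @mutual_info_ge R p q n ltac:(lra) ltac:(lra) b _ enc dec ltac:(lra).
set MI := mutual_info _ _ _ => hMI.
rewrite mulrC ler_pdivlMr// -(ler_pM2r ln20); apply: le_trans hMI.
have hdist2 : (1 - 2 * p) * \sum_z iid_pmf (bernoulli_pmf q) z * hamming R z (dec (enc z))
    <= (1 - 2 * p) * (n%:R * (dstar + 2 * delta)).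
  apply: ler_wpM2l; first lra.
  by apply: (le_trans hdist); rewrite ler_pM2l//; lra.
have hdist3 : n%:R * p + (1 - 2 * p) *
    \sum_z iid_pmf (bernoulli_pmf q) z * hamming R z (dec (enc z))
    <= n%:R * (b + 2 * delta).
  have -> : b = p + (1 - 2 * p) * dstar by rewrite /b /bconv; ring.
  apply: le_trans (lerD (lexx _) hdist2) _.
  have -> : n%:R * p + (1 - 2 * p) * (n%:R * (dstar + 2 * delta)) =
    n%:R * (p + (1 - 2 * p) * dstar + (1 - 2 * p) * (2 * delta)) by ring.
  by rewrite ler_pM2l// lerD2l; nra.
have := ler_wpM2l L0 hdist3.
have -> : (1 - h2 b - eps) * n%:R * ln 2 = n%:R * (ln 2 - hn b - eps * ln 2).
  by rewrite h2E; field; rewrite gt_eqF.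
rewrite -deltaE.
have -> : hn b = logit b * b - ln (1 - b) by rewrite /hn /logit; ring.
have : 0 < n%:R * delta by rewrite mulr_gt0.
by lra.
Qed.

Lemma mu_source : mu_TWCIB_ED (source_pmf p q) r = 1 - h2 (bconv dstar p).
Proof.
apply/eqP; rewrite eq_le; apply/andP; split.
  by apply: ge_sup => [|mu]; [exists (1 - h2 (bconv dstar p)); exact: region_mem|exact: region_le].
apply: ub_le_sup; last exact: region_mem.
by exists (1 - h2 (bconv dstar p)) => mu; exact: region_le.
Qed.

End region.

Unset Implicit Arguments.

Theorem theorem10 (R : realType) (p q : R)
  (hp : 0 < p < 1 / 2) (hq : 0 < q < 1 / 2)
  (d : measure_display) (T : measurableType d) (P : probability T R)
  (X1 X2 Y Z W : {RV P >-> bool})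
  (hX1 : distribution P X1 =1 bernoulli_prob (1 / 2))
  (hX2 : distribution P X2 =1 bernoulli_prob (1 / 2))
  (hY : distribution P Y =1 bernoulli_prob (1 / 2))
  (hmarkov : markov_chain P X2 X1 Y)
  (hX1Z : forall t : T, X1 t = X2 t (+) Z t)
  (hZ : distribution P Z =1 bernoulli_prob q)
  (hZX2 : independent P Z X2)
  (hYW : forall t : T, Y t = X1 t (+) W t)
  (hW : distribution P W =1 bernoulli_prob p)
  (hWX : independent P W (fun t => (X1 t, X2 t))) :
  forall r : R, 0 <= r ->
    mu_TWCIB_ED (joint_pmf P X1 X2 Y) r =
      1 - h2 (bconv (h2inv (pospart (h2 q - r))) p).
Proof.
move=> r r0; rewrite (@joint_pmf_source R p q _ _ _ _ _ _ Z W)//; [|lra|lra].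
exact: mu_source.
Qed.
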